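(* The social optimization problem has asymptotic solvability if and only if the following ODE system for a pair of $\mathcal S^n$-valued functions has a solution $(\Lambda_1,\Lambda_2)$ on $[0,T]$: $$\dot\Lambda_1(t)=\Psi_1(\Lambda_1(t)),\quad \Lambda_1(T)=Q_f,\quad \mathcal R_1(\Lambda_1(t))>0\ \ \forall t\in[0,T],$$ $$\dot\Lambda_2(t)=\Psi_2(\Lambda_1(t),\Lambda_2(t)),\quad \Lambda_2(T)=Q_f^\Gamma,\quad \mathcal R_2(\Lambda_1(t),\Lambda_2(t))>0\ \ \forall t\in[0,T].$$
   Context: Notation: $\mathcal S^k$ is the set of real symmetric $k\times k$ matrices; inequalities between symmetric matrices are in the positive (semi)definite order; $[y]_M^2=y^TMy$; $\|Z\|_{l_1}=\sum_{i,j}|z_{ij}|$; $\mathbf 1_{k\times l}$ is the all-ones matrix; $\otimes$ is the Kronecker product; $e^N_1,\dots,e^N_N$ is the canonical basis (column vectors) of $\mathbb R^N$. Data: $T>0$; constant real matrices $A,G,\Gamma,\Gamma_f\in\mathbb R^{n\times n}$, $B,B_0,B_1\in\mathbb R^{n\times n_1}$, $D,D_0\in\mathbb R^{n\times1}$; symmetric, possibly indefinite $Q,Q_f\in\mathcal S^n$, $R\in\mathcal S^{n_1}$. Put $Q^\Gamma=\Gamma^TQ\Gamma-Q\Gamma-\Gamma^TQ$ and $Q_f^\Gamma=\Gamma_f^TQ_f\Gamma_f-Q_f\Gamma_f-\Gamma_f^TQ_f$. Social optimization problem: $N$ agents with states $X_i\in\mathbb R^n$, controls $u_i\in\mathbb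 R^{n_1}$ and $dX_i=(AX_i+Bu_i+GX^{(N)})dt+(B_1u_i+D)dW_i+(B_0u^{(N)}+D_0)dW_0$, where $X^{(N)}=\frac1N\sum_iX_i$, $u^{(N)}=\frac1N\sum_iu_i$ and $W_0,\dots,W_N$ are independent scalar standard Brownian motions, independent of the independent square integrable initial states. The agents jointly minimize $J^{(N)}_{\rm soc}=\sum_{i=1}^N\mathbb E\big[\int_0^T([X_i-\Gamma X^{(N)}]_Q^2+[u_i]_R^2)dt+[X_i(T)-\Gamma_fX^{(N)}(T)]^2_{Q_f}\big]$. Large-scale Riccati equation: let $\mathbf A=I_N\otimes A+\mathbf 1_{N\times N}\otimes\frac GN$, $\widehat{\mathbf B}=I_N\otimes B$, $\mathbf B_0=\mathbf 1_{N\times1}\otimes\frac{B_0}N$, $\mathbf B_k=e^N_k\otimes B_1$, $\mathbf Q=I_N\otimes Q+\mathbf 1_{N\times N}\otimes\frac{Q^\Gamma}N$, $\mathbf Q_f=I_N\otimes Q_f+\mathbf 1_{N\times N}\otimes\frac{Q_f^\Gamma}N$, $\mathbf R=I_N\otimes R$, $\widehat{\mathbf I}=\mathbf 1_{1\times N}\otimes I_{n_1}$, $\mathbf e_i=(e^N_i\otimes I_{n_1})^T$, and $\mathcal M_2(Z)=\frac12\sum_{i=1}^N\mathbf e_i^T\mathbf B_i^TZ\mathbf B_i\mathbf e_i+\frac12\widehat{\mathbf I}^T\mathbf B_0^TZ\mathbf B_0\widehat{\mathbf I}$ for $Z\in\mathbb R^{Nn\times Nn}$. The Riccati ODE for the symmetric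 matrix function $\mathbf P(t)\in\mathbb R^{Nn\times Nn}$ is $$\dot{\mathbf P}=\mathbf P\widehat{\mathbf B}(\mathbf R+2\mathcal M_2(\mathbf P))^{-1}\widehat{\mathbf B}^T\mathbf P-\mathbf P\mathbf A-\mathbf A^T\mathbf P-\mathbf Q,\quad \mathbf P(T)=\mathbf Q_f,\quad \mathbf R+2\mathcal M_2(\mathbf P(t))>0\ \forall t\in[0,T].$$ Asymptotic solvability: the social optimization problem has asymptotic solvability if there exists $N_0>0$ such that for all $N\ge N_0$ the Riccati ODE has a solution $\mathbf P$ on $[0,T]$, $\sup_{N\ge N_0}\sup_{0\le t\le T}\|\mathbf P(t)\|_{l_1}/N<\infty$, and for some fixed constant $c_0>0$, $\mathbf R+2\mathcal M_2(\mathbf P(t))\ge c_0I$ for all $N\ge N_0$ and $t\in[0,T]$. Mappings: for $\Lambda_1,\Lambda_2\in\mathcal S^n$, $\mathcal R_1(\Lambda_1)=R+B_1^T\Lambda_1B_1$, $\mathcal R_2(\Lambda_1,\Lambda_2)=R+B_1^T\Lambda_1B_1+B_0^T(\Lambda_1+\Lambda_2)B_0$, and, whenever the inverses exist, $$\Psi_1(\Lambda_1)=\Lambda_1B\mathcal R_1(\Lambda_1)^{-1}B^T\Lambda_1-\Lambda_1A-A^T\Lambda_1-Q,$$ $$\Psi_2(\Lambda_1,\Lambda_2)=(\Lambda_1+\Lambda_2)B\mathcal R_2(\Lambda_1,\Lambda_2)^{-1}B^T(\Lambda_1+\Lambda_2)-\Lambda_1B\mathcal R_1(\Lambda_1)^{-1}B^T\Lambda_1-[\Lambda_1G+\Lambda_2(A+G)]-[G^T\Lambda_1+(A^T+G^T)\Lambda_2]-Q^\Gamma.$$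 *)

(* Defs.v *)
From mathcomp Require Import all_boot all_order all_algebra.
From mathcomp Require Import all_classical all_reals all_analysis.
From mathcomp Require Export mxtens.

Set Implicit Arguments.
Unset Strict Implicit.
Unset Printing Implicit Defensive.

Import Order.TTheory GRing.Theory Num.Theory.
Import numFieldNormedType.Exports.

Local Open Scope classical_set_scope.
Local Open Scope ring_scope.

Definition symmx (R : realType) (k : nat) (M : 'M[R]_k) : Prop := M^T = M.

Definition posdefmx (R : realType) (k : nat) (M : 'M[R]_k) : Prop :=
  symmx M /\ forall x : 'cV[R]_k, x != 0 -> 0 < (x^T *m M *m x) 0 0.

Definition possemidefmx (R : realType) (k : nat) (M : 'M[R]_k) : Prop :=
  symmx M /\ forall x : 'cV[R]_k, 0 <= (x^T *m M *m x) 0 0.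

Definition loewner_le (R : realType) (k : nat) (M1 M2 : 'M[R]_k) : Prop :=
  possemidefmx (M2 - M1).

Definition l1norm (R : realType) (k l : nat) (Z : 'M[R]_(k, l)) : R :=
  \sum_(i < k) \sum_(j < l) `|Z i j|.

(* Derivative relative to [0, T]: two-sided inside, one-sided at the ends, so
   that values of F outside [0, T] are irrelevant. *)
Definition has_derivative_in (R : realType) (T : R) (k l : nat)
    (F : R -> 'M[R]_(k, l)) (t : R) (dF : 'M[R]_(k, l)) : Prop :=
  (s - t)^-1 *: (F s - F t) @[s --> within `[0, T] t^'] --> dF.

(* Coefficients of the N-agent problem
     dX_i = (A X_i + B u_i + G X^(N)) dt + (B1 u_i + D) dW_i
            + (B0 u^(N) + D0) dW_0
   with running cost [X_i - Gamma X^(N)]_Q^2 + [u_i]_R^2 and terminal cost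
   [X_i(T) - Gammaf X^(N)(T)]_Qf^2.  The matrices cQ, cQf and cR may be
   indefinite. *)
Record social_problem (R : realType) (n n1 : nat) := SocialProblem {
  horizon : R;
  horizon_gt0 : 0 < horizon;
  cA : 'M[R]_n;
  cG : 'M[R]_n;
  cGamma : 'M[R]_n;
  cGammaf : 'M[R]_n;
  cB : 'M[R]_(n, n1);
  cB0 : 'M[R]_(n, n1);
  cB1 : 'M[R]_(n, n1);
  cD : 'cV[R]_n;
  cD0 : 'cV[R]_n;
  cQ : 'M[R]_n;
  cQf : 'M[R]_n;
  cR : 'M[R]_n1;
  cQ_sym : symmx cQ;
  cQf_sym : symmx cQf;
  cR_sym : symmx cR
}.

Definition QGamma (R : realType) (n n1 : nat) (p : social_problem R n n1) :
    'M[R]_n :=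
  (cGamma p)^T *m cQ p *m cGamma p - cQ p *m cGamma p - (cGamma p)^T *m cQ p.

Definition QfGamma (R : realType) (n n1 : nat) (p : social_problem R n n1) :
    'M[R]_n :=
  (cGammaf p)^T *m cQf p *m cGammaf p - cQf p *m cGammaf p
    - (cGammaf p)^T *m cQf p.

(* *t is the Kronecker product; 1 * n1 is its dimension for a width-n1 block. *)

Definition bigA (R : realType) (n n1 : nat) (p : social_problem R n n1)
    (N : nat) : 'M[R]_(N * n) :=
  (1%:M : 'M[R]_N) *t cA p + (const_mx 1 : 'M[R]_N) *t (N%:R^-1 *: cG p).

Definition bigB (R : realType) (n n1 : nat) (p : social_problem R n n1)
    (N : nat) : 'M[R]_(N * n, N * n1) :=
  (1%:M : 'M[R]_N) *t cB p.

Definition bigB0 (R : realType) (n n1 : nat) (p : social_problem R n n1)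
    (N : nat) : 'M[R]_(N * n, 1 * n1) :=
  (const_mx 1 : 'cV[R]_N) *t (N%:R^-1 *: cB0 p).

Definition bigBk (R : realType) (n n1 : nat) (p : social_problem R n n1)
    (N : nat) (k : 'I_N) : 'M[R]_(N * n, 1 * n1) :=
  (delta_mx k 0 : 'cV[R]_N) *t cB1 p.

Definition bigQ (R : realType) (n n1 : nat) (p : social_problem R n n1)
    (N : nat) : 'M[R]_(N * n) :=
  (1%:M : 'M[R]_N) *t cQ p + (const_mx 1 : 'M[R]_N) *t (N%:R^-1 *: QGamma p).

Definition bigQf (R : realType) (n n1 : nat) (p : social_problem R n n1)
    (N : nat) : 'M[R]_(N * n) :=
  (1%:M : 'M[R]_N) *t cQf p + (const_mx 1 : 'M[R]_N) *t (N%:R^-1 *: QfGamma p).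

Definition bigR (R : realType) (n n1 : nat) (p : social_problem R n n1)
    (N : nat) : 'M[R]_(N * n1) :=
  (1%:M : 'M[R]_N) *t cR p.

Definition Ihat (R : realType) (n1 N : nat) : 'M[R]_(1 * n1, N * n1) :=
  (const_mx 1 : 'rV[R]_N) *t (1%:M : 'M[R]_n1).

Definition block_e (R : realType) (n1 N : nat) (i : 'I_N) :
    'M[R]_(1 * n1, N * n1) :=
  ((delta_mx i 0 : 'cV[R]_N) *t (1%:M : 'M[R]_n1))^T.

Definition M2 (R : realType) (n n1 : nat) (p : social_problem R n n1)
    (N : nat) (Z : 'M[R]_(N * n)) : 'M[R]_(N * n1) :=
  2^-1 *: (\sum_(i < N) (block_e R n1 i)^T *m (bigBk p i)^T *m Z
                          *m bigBk p i *m block_e R n1 i)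
  + 2^-1 *: ((Ihat R n1 N)^T *m (bigB0 p N)^T *m Z *m bigB0 p N *m Ihat R n1 N).

Definition big_weight (R : realType) (n n1 : nat) (p : social_problem R n n1)
    (N : nat) (Z : 'M[R]_(N * n)) : 'M[R]_(N * n1) :=
  bigR p N + 2 *: M2 p Z.

Definition big_riccati_rhs (R : realType) (n n1 : nat)
    (p : social_problem R n n1) (N : nat) (Z : 'M[R]_(N * n)) :
    'M[R]_(N * n) :=
  Z *m bigB p N *m invmx (big_weight p Z) *m (bigB p N)^T *m Z
    - Z *m bigA p N - (bigA p N)^T *m Z - bigQ p N.

Definition big_riccati_solution (R : realType) (n n1 : nat)
    (p : social_problem R n n1) (N : nat) (P : R -> 'M[R]_(N * n)) : Prop :=
  (forall t, 0 <= t <= horizon p ->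
     [/\ symmx (P t),
         has_derivative_in (horizon p) P t (big_riccati_rhs p (P t)) &
         posdefmx (big_weight p (P t))])
  /\ P (horizon p) = bigQf p N.

Definition asymptotic_solvability (R : realType) (n n1 : nat)
    (p : social_problem R n n1) : Prop :=
  exists (N0 : nat) (P : forall N : nat, R -> 'M[R]_(N * n)),
    [/\ (0 < N0)%N,
        forall N, (N0 <= N)%N -> big_riccati_solution p (P N),
        (ereal_sup [set ereal_sup [set (l1norm (P N t) / N%:R)%:E
                                  | t in [set t : R | (0 <= t <= horizon p)%R]]
                   | N in [set N : nat | (N0 <= N)%N]] < +oo)%E &
        exists c0 : R, 0 < c0 /\
          forall (N : nat) (t : R), (N0 <= N)%N -> 0 <= t <= horizon p ->
            loewner_le c0%:M (big_weight p (P N t))].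

Definition R1 (R : realType) (n n1 : nat) (p : social_problem R n n1)
    (L1 : 'M[R]_n) : 'M[R]_n1 :=
  cR p + (cB1 p)^T *m L1 *m cB1 p.

Definition R2 (R : realType) (n n1 : nat) (p : social_problem R n n1)
    (L1 L2 : 'M[R]_n) : 'M[R]_n1 :=
  cR p + (cB1 p)^T *m L1 *m cB1 p + (cB0 p)^T *m (L1 + L2) *m cB0 p.

(* invmx is total; Psi1 and Psi2 are only used below where R1 and R2 are
   positive definite, hence invertible. *)
Definition Psi1 (R : realType) (n n1 : nat) (p : social_problem R n n1)
    (L1 : 'M[R]_n) : 'M[R]_n :=
  L1 *m cB p *m invmx (R1 p L1) *m (cB p)^T *m L1
    - L1 *m cA p - (cA p)^T *m L1 - cQ p.

Definition Psi2 (R : realType) (n n1 : nat) (p : social_problem R n n1)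
    (L1 L2 : 'M[R]_n) : 'M[R]_n :=
  (L1 + L2) *m cB p *m invmx (R2 p L1 L2) *m (cB p)^T *m (L1 + L2)
    - L1 *m cB p *m invmx (R1 p L1) *m (cB p)^T *m L1
    - (L1 *m cG p + L2 *m (cA p + cG p))
    - ((cG p)^T *m L1 + ((cA p)^T + (cG p)^T) *m L2)
    - QGamma p.

Definition limit_ode_solution (R : realType) (n n1 : nat)
    (p : social_problem R n n1) (L1 L2 : R -> 'M[R]_n) : Prop :=
  [/\ forall t, 0 <= t <= horizon p -> symmx (L1 t) /\ symmx (L2 t),
      [/\ forall t, 0 <= t <= horizon p ->
            has_derivative_in (horizon p) L1 t (Psi1 p (L1 t)),
          L1 (horizon p) = cQf p &
          forall t, 0 <= t <= horizon p -> posdefmx (R1 p (L1 t))] &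
      [/\ forall t, 0 <= t <= horizon p ->
            has_derivative_in (horizon p) L2 t (Psi2 p (L1 t) (L2 t)),
          L2 (horizon p) = QfGamma p &
          forall t, 0 <= t <= horizon p -> posdefmx (R2 p (L1 t) (L2 t))]].

(* Main.v *)
Require Import Defs.
From mathcomp Require Import all_boot all_order all_algebra.
From mathcomp Require Import all_classical all_reals all_analysis.
From mathcomp Require Import fingroup perm ring lra.

(** Let E be the orthogonal projection of R^N onto the constant vectors. The
    coefficients A, B, Q, R of the N-agent Riccati equation are of the form
    (I - E) (x) U + E (x) V, an exchangeable block matrix ([exch_mx]): U acts on
    the fluctuations of the agents around their mean and V on the mean itself.
    The noise term of the weight maps exchangeable matrices to such. Sums,
    products, transposes, inverses and definiteness are computed separately on
    U and V, so that on exchangeable P = [exch_mx N X S] the large equation is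
    equivalent to a pair of Riccati equations of size n for (X, S)
    ([big_riccati_rhs_exch]). The pair depends on N only through [eps = 1/N],
    which enters through the term
      B1^T ((1 - eps) X + eps S) B1
    of the weights (the diagonal block of P is (1 - eps) X + eps S), and its
    terminal value does not depend on N at all. For eps = 0 it is the limit
    system, with X = L1 and S = L1 + L2.

    Asymptotic solvability gives the limit system. A relabelling of the agents
    maps solutions of the large equation to solutions, and Gronwall's inequality
    gives uniqueness; hence P_N is invariant under all permutations and
    therefore exchangeable ([exchangeable_exch]). The l1 bound of order N on P_N
    becomes a bound on (X_N, S_N) that is uniform in N ([exch_l1norm]), and the
    lower bound on the large weight passes to both small weights
    ([exch_coercive]). On the resulting set the small vector field is Lipschitz
    in (X, S) and in eps, so a second use of Gronwall's inequality
    ([pair_gronwall]) shows that (X_N, S_N) is a uniform Cauchy sequence; its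
    limit solves the system for eps = 0 ([pair_limit]).

    Conversely, along a solution of the limit system the weights are positive
    definite, hence uniformly coercive by compactness of [0, T]
    ([coercive_uniform]), and they remain coercive in a tube around it for small
    eps. The limit solution satisfies the system for small eps up to a defect
    of order eps, so that Picard iteration stays in the tube and converges to an
    exact solution ([picard_near], [pair_near_limit]). It is symmetric by
    uniqueness, and P_N = [exch_mx N X_N S_N] is the required large solution.

    Both existence and Gronwall's inequality rest on one estimate: integrating
    backwards from T a bound of the form a exp(K (T - t)) gains a factor 1/K
    ([deriv_on_expR]), which for large K beats any Lipschitz constant. *)

Set Implicit Arguments.
Unset Strict Implicit.
Unset Printing Implicit Defensive.

Import Order.TTheory GRing.Theory Num.Theory.
Import numFieldNormedType.Exports.

Local Open Scope classical_set_scope.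
Local Open Scope ring_scope.

(** * The entrywise l1 norm *)

Lemma l1norm_ge0 (R : realType) (k l : nat) (Z : 'M[R]_(k, l)) : 0 <= l1norm Z.
Proof. by apply: sumr_ge0 => i _; apply: sumr_ge0 => j _. Qed.

Lemma l1normD (R : realType) (k l : nat) (Y Z : 'M[R]_(k, l)) :
  l1norm (Y + Z) <= l1norm Y + l1norm Z.
Proof.
rewrite /l1norm -big_split /=; apply: ler_sum => i _.
rewrite -big_split /=; apply: ler_sum => j _; rewrite mxE; exact: ler_normD.
Qed.

Lemma l1normN (R : realType) (k l : nat) (Z : 'M[R]_(k, l)) :
  l1norm (- Z) = l1norm Z.
Proof.
by apply: eq_bigr => i _; apply: eq_bigr => j _; rewrite mxE normrN.
Qed.

Lemma l1normB (R : realType) (k l : nat) (Y Z : 'M[R]_(k, l)) :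
  l1norm (Y - Z) <= l1norm Y + l1norm Z.
Proof. by rewrite -(l1normN Z); exact: l1normD. Qed.

Lemma l1norm_distC (R : realType) (k l : nat) (Y Z : 'M[R]_(k, l)) :
  l1norm (Y - Z) = l1norm (Z - Y).
Proof. by rewrite -l1normN opprB. Qed.

Lemma l1norm_distD (R : realType) (k l : nat) (Y X Z : 'M[R]_(k, l)) :
  l1norm (X - Z) <= l1norm (X - Y) + l1norm (Y - Z).
Proof. by rewrite (le_trans _ (l1normD _ _))// addrA subrK. Qed.

Lemma l1normZ (R : realType) (k l : nat) (a : R) (Z : 'M[R]_(k, l)) :
  l1norm (a *: Z) = `|a| * l1norm Z.
Proof.
rewrite /l1norm mulr_sumr; apply: eq_bigr => i _.
by rewrite mulr_sumr; apply: eq_bigr => j _; rewrite mxE normrM.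
Qed.

Lemma l1norm0 (R : realType) (k l : nat) : l1norm (0 : 'M[R]_(k, l)) = 0.
Proof. by rewrite /l1norm big1// => i _; rewrite big1// => j _; rewrite mxE normr0. Qed.

Lemma l1norm_entry (R : realType) (k l : nat) (Z : 'M[R]_(k, l)) i j :
  `|Z i j| <= l1norm Z.
Proof.
rewrite /l1norm (bigD1 i)//= (bigD1 j)//= -addrA lerDl.
by rewrite addr_ge0 ?sumr_ge0// => i' _; rewrite sumr_ge0.
Qed.

Lemma l1norm_le (R : realType) (k l : nat) (Z : 'M[R]_(k, l)) (b : R) :
  (forall i j, `|Z i j| <= b) -> l1norm Z <= (k * l)%:R * b.
Proof.
move=> Zb; rewrite /l1norm.
have -> : (k * l)%:R * b = \sum_(i < k) \sum_(j < l) b.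
  under eq_bigr do rewrite sumr_const card_ord.
  by rewrite sumr_const card_ord -mulrnA mulr_natl mulnC.
by apply: ler_sum => i _; apply: ler_sum.
Qed.

Lemma l1norm_le0 (R : realType) (k l : nat) (Z : 'M[R]_(k, l)) :
  l1norm Z <= 0 -> Z = 0.
Proof.
move=> Z0; apply/matrixP => i j; rewrite mxE; apply/eqP.
by rewrite -normr_le0 (le_trans (l1norm_entry Z i j)).
Qed.

Lemma l1normM (R : realType) (k l m : nat) (Y : 'M[R]_(k, l))
  (Z : 'M[R]_(l, m)) : l1norm (Y *m Z) <= l1norm Y * l1norm Z.
Proof.
rewrite /l1norm mulr_suml; apply: ler_sum => i _.
apply: (@le_trans _ _ (\sum_(j < m) \sum_(h < l) `|Y i h| * `|Z h j|)).
  apply: ler_sum => j _; rewrite mxE (le_trans (ler_norm_sum _ _ _))//.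
  by apply: ler_sum => h _; rewrite normrM.
rewrite exchange_big mulr_suml /=; apply: ler_sum => h _.
rewrite -mulr_sumr; apply: ler_wpM2l => //.
rewrite [leRHS](bigD1 h)//= lerDl sumr_ge0// => i' _; rewrite sumr_ge0//.
Qed.

Lemma l1norm_tr (R : realType) (k l : nat) (Z : 'M[R]_(k, l)) :
  l1norm Z^T = l1norm Z.
Proof.
rewrite /l1norm exchange_big; apply: eq_bigr => i _; apply: eq_bigr => j _.
by rewrite mxE.
Qed.

Lemma l1norm_row_mx (R : realType) (k l m : nat) (Y : 'M[R]_(k, l))
  (Z : 'M[R]_(k, m)) : l1norm (row_mx Y Z) = l1norm Y + l1norm Z.
Proof.
rewrite /l1norm -big_split; apply: eq_bigr => i _ /=; rewrite big_split_ord /=.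
by congr (_ + _); apply: eq_bigr => j _; rewrite ?row_mxEl ?row_mxEr.
Qed.

Lemma l1norm_hsub (R : realType) (k l m : nat) (Y : 'M[R]_(k, l + m)) :
  l1norm Y = l1norm (lsubmx Y) + l1norm (rsubmx Y).
Proof. by rewrite -[in LHS](hsubmxK Y) l1norm_row_mx. Qed.

(** * Calculus relative to a compact interval *)

(** An inequality without quotients: it is trivial at [s = t] and stable under
    uniform limits. *)
Definition deriv_on (R : realType) (T : R) (f : R -> R) (t d : R) : Prop :=
  forall e, 0 < e -> exists2 h, 0 < h & forall s, 0 <= s <= T ->
    `|s - t| < h -> `|f s - f t - (s - t) * d| <= e * `|s - t|.

Lemma has_derivative_inP (R : realType) (T : R) (k l : nat)
    (F : R -> 'M[R]_(k, l)) (t : R) (dF : 'M[R]_(k, l)) :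
  has_derivative_in T F t dF <->
  forall i j, deriv_on T (fun s => F s i j) t (dF i j).
Proof.
rewrite /has_derivative_in; split.
  move=> /cvg_ballP Fd i j e e0.
  have := Fd _ e0; rewrite /within/= => /nbhs_ballP[h/= h0 hP].
  exists h => // s sT st.
  have [->|sNt] := eqVneq s t; first by rewrite !subrr mul0r subrr normr0 mulr0.
  have := hP s; rewrite /ball/= distrC => /(_ st sNt).
  have -> : [set` `[0, T]] s by rewrite /= in_itv.
  case=> // _ /(_ i j); rewrite /ball/= !mxE => le1.
  have st0 : s - t != 0 by rewrite subr_eq0.
  have -> : F s i j - F t i j - (s - t) * dF i j =
     - ((dF i j - (s - t)^-1 * (F s i j - F t i j)) * (s - t)).
    by field.
  by rewrite normrN normrM ler_wpM2r// ltW.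
move=> Fd; apply/cvg_ballP => e e0.
have e20 : 0 < e / 2 by rewrite divr_gt0.
have H : \forall s \near within `[0, T] t^', forall i j,
    ball (dF i j) e (((s - t)^-1 *: (F s - F t)) i j).
  apply: filter_forall => i; apply: filter_forall => j.
  have [h h0 hP] := Fd i j _ e20.
  rewrite /within/=; apply/nbhs_ballP; exists h => //= s; rewrite /ball/= distrC.
  move=> st sNt; rewrite in_itv/= => sT.
  have := hP s sT st.
  have st0 : s - t != 0 by rewrite subr_eq0.
  have -> : F s i j - F t i j - (s - t) * dF i j =
     - ((dF i j - (s - t)^-1 * (F s i j - F t i j)) * (s - t)).
    by field.
  rewrite normrN normrM ler_pM2r ?normr_gt0// => /le_lt_trans; rewrite !mxE; apply.
  lra.
by near=> s; split => //; near: s.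
Unshelve. all: by end_near. Qed.

Definition cont_on (R : realType) (T : R) (f : R -> R) : Prop :=
  forall t, 0 <= t <= T -> forall e, 0 < e ->
  exists2 h, 0 < h & forall s, 0 <= s <= T -> `|s - t| < h -> `|f s - f t| <= e.

Lemma deriv_on_cont (R : realType) (T : R) (f df : R -> R) :
  (forall t, 0 <= t <= T -> deriv_on T f t (df t)) -> cont_on T f.
Proof.
move=> fd t tT e e0; have [h h0 hP] := fd t tT 1 ltr01.
pose c := 1 + `|df t|; have c0 : 0 < c by rewrite /c ltr_wpDr.
exists (Num.min h (e / c)); first by rewrite lt_min h0 divr_gt0.
move=> s sT; rewrite lt_min => /andP[st1 st2].
have := hP s sT st1; rewrite mul1r => le1.
have -> : f s - f t = f s - f t - (s - t) * df t + (s - t) * df t by ring.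
apply: le_trans (ler_normD _ _) _; rewrite normrM.
apply: (@le_trans _ _ (`|s - t| * c)); first by rewrite /c mulrDr mulr1 lerD.
by rewrite -ler_pdivlMr// ltW.
Qed.

Lemma cont_on_within (R : realType) (T : R) (f : R -> R) :
  cont_on T f -> {within `[0, T], continuous f}.
Proof.
move=> fc; apply/subspace_continuousP => t /=; rewrite in_itv/= => tT.
apply/cvgrPdist_le => e e0; have [h h0 hP] := fc t tT e e0.
rewrite /within/=; apply/nbhs_ballP; exists h => //= s.
by rewrite /ball/= distrC in_itv/= => st sT; rewrite distrC; exact: hP.
Qed.

Lemma deriv_on_is_derive (R : realType) (T : R) (f : R -> R) (t d : R) :
  0 < t < T -> deriv_on T f t d -> is_derive t 1 f d.
Proof.
move=> /andP[t0 tT] fd.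
suff H : h^-1 *: ((f \o shift t) (h *: 1) - f t) @[h --> 0^'] --> d.
  apply: DeriveDef; first by apply/cvg_ex; exists d.
  exact/cvg_lim.
apply/cvgrPdist_le => e e0; have [h h0 hP] := fd e e0.
near=> s => /=.
have s0 : s != 0 by near: s; exact: nbhs_dnbhs_neq.
have ss : `|s| < Num.min h (Num.min t (T - t)).
  near: s; apply/dnbhs0_lt; by rewrite !lt_min h0 t0 subr_gt0 tT.
move: ss; rewrite !lt_min => /and3P[s1 s2 s3].
have := hP (s + t); rewrite addrK => /(_ _ s1).
move: s2 s3; rewrite !ltr_norml => /andP[? ?] /andP[? ?].
have bT : 0 <= s + t <= T by apply/andP; split; lra.
move=> /(_ bT) H; rewrite [s *: _]mulr1.
have -> : d - s^-1 *: (f (s + t) - f t) = - (s^-1 * (f (s + t) - f t - s * d)).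
  by rewrite mulrBr mulrA mulVf// mul1r opprB.
rewrite normrN normrM normfV mulrC ler_pdivrMr ?normr_gt0//.
Unshelve. all: by end_near. Qed.

(** Both [g - f] and [g + f] have nonnegative derivative. A linear [g] yields
    the Lipschitz bound, an exponential [g] the weighted one. *)
Lemma deriv_on_le (R : realType) (T : R) (f df g dg : R -> R) (s t : R) :
  0 <= s -> s <= t -> t <= T ->
  (forall x : R, 0 <= x <= T -> deriv_on T f x (df x)) ->
  (forall x : R, 0 < x < T -> is_derive x 1 g (dg x)) ->
  {within `[0, T], continuous g} ->
  (forall x : R, 0 <= x <= T -> `|df x| <= dg x) ->
  `|f t - f s| <= g t - g s.
Proof.
move=> s0 st tT fd gd gc dfg.
have fc := cont_on_within (deriv_on_cont fd).
have sub : `[s, t] `<=` `[0, T].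
  by move=> x; rewrite /= !in_itv/= => /andP[? ?]; apply/andP; split; lra.
have fc' := continuous_subspaceW sub fc.
have gc' := continuous_subspaceW sub gc.
have int x : x \in `]s, t[ -> 0 < x < T /\ 0 <= x <= T.
  by rewrite in_itv/= => /andP[? ?]; split; apply/andP; split; lra.
have fd' x : x \in `]s, t[ -> is_derive x 1 f (df x).
  by move=> /int[x1 x2]; apply: deriv_on_is_derive x1 (fd _ x2).
have gd' x : x \in `]s, t[ -> is_derive x 1 g (dg x).
  by move=> /int[x1 x2]; exact: gd.
have up : f t - f s <= g t - g s.
  have [x||c cst] := @MVT_segment R (g - f) (fun x => dg x - df x) s t st.
  - by move=> xst; apply: is_deriveB; [exact: gd'|exact: fd'].
  - exact: within_continuousB gc' fc'.
  - have cT : 0 <= c <= T by move: cst; rewrite in_itv/= => /andP[? ?]; apply/andP; split; lra.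
    move=> E; have : 0 <= (dg c - df c) * (t - s).
      by rewrite mulr_ge0 ?subr_ge0// (le_trans (ler_norm _))// dfg.
    by rewrite -E /= -[(g - f) t]/(g t - f t) -[(g - f) s]/(g s - f s); lra.
have dn : f s - f t <= g t - g s.
  have [x||c cst] := @MVT_segment R (g + f) (fun x => dg x + df x) s t st.
  - by move=> xst; apply: is_deriveD; [exact: gd'|exact: fd'].
  - exact: within_continuousD gc' fc'.
  - have cT : 0 <= c <= T by move: cst; rewrite in_itv/= => /andP[? ?]; apply/andP; split; lra.
    move=> E; have : 0 <= (dg c + df c) * (t - s).
      rewrite mulr_ge0 ?subr_ge0// -[df c]opprK subr_ge0.
      by rewrite (le_trans (ler_norm _))// normrN dfg.
    by rewrite -E /= -[(g + f) t]/(g t + f t) -[(g + f) s]/(g s + f s); lra.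
by rewrite ler_norml up andbT; lra.
Qed.

Lemma deriv_on_lip (R : realType) (T : R) (f df : R -> R) (c s t : R) :
  0 <= s <= T -> 0 <= t <= T ->
  (forall x : R, 0 <= x <= T -> deriv_on T f x (df x)) ->
  (forall x : R, 0 <= x <= T -> `|df x| <= c) ->
  `|f t - f s| <= c * `|t - s|.
Proof.
wlog st : s t / s <= t => [W|].
  case: (leP s t) => [|/ltW] st; first exact: W.
  by move=> sT tT H1 H2; rewrite distrC (distrC t); exact: W.
move=> /andP[s0 sT] /andP[t0 tT] fd dfc.
have := @deriv_on_le R T f df (fun x => c * x) (fun=> c) s t s0 st tT fd.
rewrite -mulrBr (@ger0_norm _ (t - s)) ?subr_ge0//; apply => //.
- move=> x _; have := is_deriveZ c (is_derive_id x (1 : R)).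
  by rewrite [c *: 1]mulr1.
- by apply: continuous_subspaceT => x; apply: continuousM;
    [exact: cst_continuous|exact: cvg_id].
Qed.

(** Integrating an exponentially growing bound backwards from the horizon
    gains the factor [K^-1]; a large weight [K] thus turns Lipschitz estimates
    into contraction estimates. *)
Lemma deriv_on_expR (R : realType) (T K a : R) (f df : R -> R) (t : R) :
  0 < K -> 0 <= a -> 0 <= t <= T -> f T = 0 ->
  (forall x : R, 0 <= x <= T -> deriv_on T f x (df x)) ->
  (forall x : R, 0 <= x <= T -> `|df x| <= a * expR (K * (T - x))) ->
  `|f t| <= a / K * expR (K * (T - t)).
Proof.
move=> K0 a0 /andP[t0 tT] fT fd dfa.
pose g x := - (a / K) * expR (K * (T - x)).
have gd (x : R) : is_derive x 1 g (a * expR (K * (T - x))).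
  rewrite /g.
  have d1 : is_derive x 1 (fun y => K * (T - y)) (- K).
    have := is_deriveZ K (is_deriveB (is_derive_cst T x 1) (is_derive_id x (1:R))).
    by rewrite sub0r scalerN [K *: 1]mulr1.
  have d2 := @is_derive1_comp _ expR (fun y => K * (T - y)) x _ _ (is_derive_expR _) d1.
  have := is_deriveZ (- (a / K)) d2.
  set u := (X in is_derive _ _ _ X -> _); set v := (X in _ -> is_derive _ _ _ X).
  suff -> : u = v by [].
  rewrite /u /v /GRing.scale/=.
  by field; rewrite gt_eqF.
have := @deriv_on_le R T f df g (fun x => a * expR (K * (T - x))) t T t0 tT (lexx _) fd.
rewrite fT sub0r normrN => /(_ (fun x _ => gd x)) H.
apply: le_trans (H _ dfa) _.
  apply: continuous_subspaceT => x; apply/differentiable_continuous.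
  by apply/derivable1_diffP; case: (gd x).
rewrite /g subrr mulr0 expR0 mulr1 mulNr opprK gerDr oppr_le0.
by rewrite divr_ge0 // ltW.
Qed.

(** Finitely many entries share a common radius. *)
Lemma entrywise_radius (R : realType) (T t : R) (k l : nat)
    (P : 'I_k -> 'I_l -> R -> Prop) :
  (forall i j, exists2 h, 0 < h & forall s, 0 <= s <= T -> `|s - t| < h -> P i j s) ->
  exists2 h, 0 < h & forall s, 0 <= s <= T -> `|s - t| < h -> forall i j, P i j s.
Proof.
move=> HP.
have H : \forall h \near (0 : R)^'+, forall i j, forall s, 0 <= s <= T ->
    `|s - t| < h -> P i j s.
  apply: filter_forall => i; apply: filter_forall => j.
  have [h h0 hP] := HP i j.
  near=> x => s sT sx; apply: hP => //; apply: lt_le_trans sx _.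
  by near: x; exact: nbhs_right_le.
near ((0 : R)^'+) => h; exists h; first by near: h; exact: nbhs_right_gt.
by move=> s sT st i j; apply: (near H h).
Unshelve. all: by end_near. Qed.

Definition cont_mx (R : realType) (T : R) (k l : nat) (Y : R -> 'M[R]_(k, l)) :
    Prop :=
  forall t, 0 <= t <= T -> forall e, 0 < e ->
  exists2 h, 0 < h & forall s, 0 <= s <= T -> `|s - t| < h ->
    l1norm (Y s - Y t) <= e.

Lemma cont_mx_entry (R : realType) (T : R) (k l : nat) (Y : R -> 'M[R]_(k, l))
    i j : cont_mx T Y -> cont_on T (fun s => Y s i j).
Proof.
move=> Yc t tT e e0; have [h h0 hP] := Yc t tT e e0; exists h => // s sT st.
have := l1norm_entry (Y s - Y t) i j; rewrite !mxE => /le_trans; apply.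
exact: hP.
Qed.

Lemma has_derivative_in_cont (R : realType) (T : R) (k l : nat)
    (Y dY : R -> 'M[R]_(k, l)) :
  (forall t, 0 <= t <= T -> has_derivative_in T Y t (dY t)) -> cont_mx T Y.
Proof.
move=> Yd t tT e e0; pose c := (k * l)%:R + 1 : R.
have c0 : 0 < c by rewrite /c ltr_wpDl.
have [i j|h h0 hP] := @entrywise_radius R T t k l
    (fun i j s => `|Y s i j - Y t i j| <= e / c).
  have H : cont_on T (fun s => Y s i j).
    apply: (@deriv_on_cont R T _ (fun s => dY s i j)) => x xT.
    by have /has_derivative_inP := Yd x xT; exact.
  exact: H (divr_gt0 e0 c0).
exists h => // s sT st.
apply: (@le_trans _ _ ((k * l)%:R * (e / c))).
  by apply: l1norm_le => i j; rewrite !mxE; exact: hP.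
by rewrite mulrCA ler_piMr ?(ltW e0)// ler_pdivrMr// mul1r /c lerDl.
Qed.

(** The chain rule for a linear [f]: the remainder of [f (F s)] is the image of
    the remainder of [F], and [f] is bounded. *)
Lemma has_derivative_in_linear (R : realType) (T : R) (k l k' l' : nat)
    (f : 'M[R]_(k, l) -> 'M[R]_(k', l')) (c : R)
    (F : R -> 'M[R]_(k, l)) (t : R) (dF : 'M[R]_(k, l)) :
  (forall a Y Z, f (Y - a *: Z) = f Y - a *: f Z) ->
  (forall Y, l1norm (f Y) <= c * l1norm Y) ->
  has_derivative_in T F t dF ->
  has_derivative_in T (fun s => f (F s)) t (f dF).
Proof.
move=> fl fb /has_derivative_inP Fd; apply/has_derivative_inP => i j e e0.
have fB Y Z : f (Y - Z) = f Y - f Z by rewrite -[Z in LHS]scale1r fl scale1r.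
(* the added 1 makes the denominator positive also in dimension 0 *)
pose c' := (k * l)%:R * `|c| + 1.
have c'0 : 0 < c' by rewrite /c' ltr_wpDl// mulr_ge0.
have [h h0 hP] := entrywise_radius (fun i j => Fd i j _ (divr_gt0 e0 c'0)).
exists h => // s sT st.
have := l1norm_entry (f (F s) - f (F t) - (s - t) *: f dF) i j.
rewrite !mxE => /le_trans; apply; rewrite -fB -fl.
apply: le_trans (fb _) _.
apply: (@le_trans _ _ (`|c| * ((k * l)%:R * (e / c' * `|s - t|)))).
  apply: (@le_trans _ _ (`|c| * l1norm (F s - F t - (s - t) *: dF))).
    by rewrite ler_wpM2r ?l1norm_ge0// ler_norm.
  rewrite ler_wpM2l// l1norm_le// => i' j'; rewrite !mxE; exact: hP.
have -> : `|c| * ((k * l)%:R * (e / c' * `|s - t|)) =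
  (c' - 1) / c' * (e * `|s - t|).
  by rewrite /c'; field; rewrite gt_eqF.
rewrite ler_piMl ?mulr_ge0 ?(ltW e0)//.
by rewrite ler_pdivrMr// mul1r gerBl.
Qed.

Lemma has_derivative_inB (R : realType) (T : R) (k l : nat)
    (F G : R -> 'M[R]_(k, l)) (t : R) (dF dG : 'M[R]_(k, l)) :
  has_derivative_in T F t dF -> has_derivative_in T G t dG ->
  has_derivative_in T (fun s => F s - G s) t (dF - dG).
Proof.
rewrite /has_derivative_in => Fd Gd.
have -> : (fun s => (s - t)^-1 *: (F s - G s - (F t - G t))) =
    (fun s => (s - t)^-1 *: (F s - F t)) \- (fun s => (s - t)^-1 *: (G s - G t)).
  apply/funext => s /=; rewrite -scalerBr; congr (_ *: _).
  by apply/matrixP => i j; rewrite !mxE; ring.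
exact: cvgB.
Qed.

Lemma has_derivative_in_row_mx (R : realType) (T : R) (k l m : nat)
    (F : R -> 'M[R]_(k, l)) (G : R -> 'M[R]_(k, m)) t dF dG :
  has_derivative_in T F t dF -> has_derivative_in T G t dG ->
  has_derivative_in T (fun s => row_mx (F s) (G s)) t (row_mx dF dG).
Proof.
move=> /has_derivative_inP Fd /has_derivative_inP Gd; apply/has_derivative_inP => i j.
rewrite -(splitK j); case: (fintype.split j) => j' /=.
  rewrite row_mxEl; have -> : (fun s => row_mx (F s) (G s) i (lshift m j')) =
    (fun s => F s i j') by apply/funext => s; rewrite row_mxEl.
  exact: Fd.
rewrite row_mxEr; have -> : (fun s => row_mx (F s) (G s) i (rshift l j')) =
  (fun s => G s i j') by apply/funext => s; rewrite row_mxEr.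
exact: Gd.
Qed.

Lemma has_derivative_inD (R : realType) (T : R) (k l : nat)
    (F G : R -> 'M[R]_(k, l)) (t : R) (dF dG : 'M[R]_(k, l)) :
  has_derivative_in T F t dF -> has_derivative_in T G t dG ->
  has_derivative_in T (fun s => F s + G s) t (dF + dG).
Proof.
rewrite /has_derivative_in => Fd Gd.
have -> : (fun s => (s - t)^-1 *: (F s + G s - (F t + G t))) =
    (fun s => (s - t)^-1 *: (F s - F t)) \+ (fun s => (s - t)^-1 *: (G s - G t)).
  by apply/funext => s /=; rewrite -scalerDr opprD addrACA.
exact: cvgD.
Qed.

Lemma has_derivative_in_lsub (R : realType) (T : R) (k l m : nat)
    (Y : R -> 'M[R]_(k, l + m)) t dY : has_derivative_in T Y t dY ->
  has_derivative_in T (fun s => lsubmx (Y s)) t (lsubmx dY).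
Proof.
apply: (@has_derivative_in_linear R T _ _ _ _ (@lsubmx _ k l m) 1) => [a U V|U].
  by rewrite linearB linearZ.
by rewrite mul1r [leRHS]l1norm_hsub lerDl l1norm_ge0.
Qed.

Lemma has_derivative_in_rsub (R : realType) (T : R) (k l m : nat)
    (Y : R -> 'M[R]_(k, l + m)) t dY : has_derivative_in T Y t dY ->
  has_derivative_in T (fun s => rsubmx (Y s)) t (rsubmx dY).
Proof.
apply: (@has_derivative_in_linear R T _ _ _ _ (@rsubmx _ k l m) 1) => [a U V|U].
  by rewrite linearB linearZ.
by rewrite mul1r [leRHS]l1norm_hsub lerDr l1norm_ge0.
Qed.

(** * Gronwall's inequality *)

Lemma weighted_bound (R : realType) (k l : nat) (T K a : R)
    (W dW : R -> 'M[R]_(k, l)) :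
  0 < K -> 0 <= a -> W T = 0 ->
  (forall t, 0 <= t <= T -> has_derivative_in T W t (dW t)) ->
  (forall t, 0 <= t <= T -> l1norm (dW t) <= a * expR (K * (T - t))) ->
  forall t, 0 <= t <= T ->
    l1norm (W t) <= (k * l)%:R * a / K * expR (K * (T - t)).
Proof.
move=> K0 a0 WT Wd dWa t tT; rewrite -!mulrA; apply: l1norm_le => i j.
rewrite mulrA.
apply: (@deriv_on_expR R T K a (fun s => W s i j) (fun s => dW s i j)) => //.
- by rewrite WT mxE.
- by move=> x xT; have /has_derivative_inP := Wd x xT; exact.
- by move=> x xT; apply: le_trans (l1norm_entry _ _ _) (dWa x xT).
Qed.

(** The factor [k * l] is lost when passing from entries to the l1 norm; the
    rate is chosen such that [k * l * L / rate] is at most one half. *)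
Definition gronwall_rate (R : realType) (k l : nat) (L : R) : R :=
  2 * (k * l)%:R * L + 1.

Definition gronwall_const (R : realType) (k l : nat) (T L : R) : R :=
  2 * (k * l)%:R * expR (gronwall_rate k l L * T).

Lemma gronwall_const_ge0 (R : realType) (k l : nat) (T L : R) :
  0 <= gronwall_const k l T L.
Proof. by rewrite !mulr_ge0 ?expR_ge0. Qed.

Lemma gronwall_rate_gt0 (R : realType) (k l : nat) (L : R) :
  0 <= L -> 0 < gronwall_rate k l L.
Proof. by move=> L0; rewrite /gronwall_rate ltr_wpDl// !mulr_ge0. Qed.

(** The common core of Gronwall's inequality and of Picard iteration: for the
    exponentially weighted sup norm, integration halves a Lipschitz term. *)
Lemma gronwall_step (R : realType) (k l : nat) (T L m d : R)
    (W dW : R -> 'M[R]_(k, l)) :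
  0 <= L -> 0 <= m -> 0 <= d -> W T = 0 ->
  (forall t, 0 <= t <= T -> has_derivative_in T W t (dW t)) ->
  (forall t, 0 <= t <= T ->
     l1norm (dW t) <= (L * m + d) * expR (gronwall_rate k l L * (T - t))) ->
  forall t, 0 <= t <= T ->
    l1norm (W t) <= (m / 2 + (k * l)%:R * d) * expR (gronwall_rate k l L * (T - t)).
Proof.
move=> L0 m0 d0 WT Wd dWb t tT; have K0 := gronwall_rate_gt0 k l L0.
have a0 : 0 <= L * m + d by rewrite addr_ge0// mulr_ge0.
apply: le_trans (weighted_bound K0 a0 WT Wd dWb tT) _.
rewrite ler_wpM2r ?expR_ge0// ler_pdivrMr// /gronwall_rate.
have dd : 0 <= (k * l)%:R * d by rewrite mulr_ge0.
have dLd : 0 <= (k * l)%:R * L * ((k * l)%:R * d) by rewrite !mulr_ge0.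
rewrite -subr_ge0; set x := (k * l)%:R in dd dLd *.
have -> : (m / 2 + x * d) * (2 * x * L + 1) - x * (L * m + d) =
   m / 2 + 2 * (x * L * (x * d)) by field.
by rewrite addr_ge0 ?mulr_ge0// divr_ge0.
Qed.

Lemma le_halving (R : realType) (x a b : R) :
  (forall m : nat, x <= a / 2 ^+ m + b) -> x <= b.
Proof.
move=> H; apply/ler_addgt0Pr => e e0.
pose m := Num.trunc (`|a| / e); have mP : `|a| / e < m.+1%:R.
  by rewrite truncnS_gt.
apply: le_trans (H m.+1) _; rewrite addrC lerD2l.
apply: le_trans (ler_norm _) _; rewrite normrM normfV (ger0_norm (exprn_ge0 _ _))//.
rewrite ler_pdivrMr ?exprn_gt0// mulrC -ler_pdivrMr//.
by apply: le_trans (ltW mP) _; rewrite -natrX ler_nat ltnW// ltn_expl.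
Qed.

(** Gronwall's inequality, backwards from the horizon: an a priori bound on
    [W] is improved by the factor one half, up to a multiple of [d], as often
    as wanted. *)
Lemma gronwall (R : realType) (k l : nat) (T L M d : R)
    (W dW : R -> 'M[R]_(k, l)) :
  0 <= L -> 0 <= d -> W T = 0 ->
  (forall t, 0 <= t <= T -> has_derivative_in T W t (dW t)) ->
  (forall t, 0 <= t <= T -> l1norm (W t) <= M) ->
  (forall t, 0 <= t <= T -> l1norm (dW t) <= L * l1norm (W t) + d) ->
  forall t, 0 <= t <= T -> l1norm (W t) <= gronwall_const k l T L * d.
Proof.
move=> L0 d0 WT Wd WM dWb.
have K0 := gronwall_rate_gt0 k l L0.
have ex1 t : 0 <= t <= T -> 1 <= expR (gronwall_rate k l L * (T - t)).
  move=> /andP[t0 tT]; rewrite -(@expR0 R) ler_expR mulr_ge0 ?(ltW K0)//.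
  by rewrite subr_ge0.
have H m : forall t, 0 <= t <= T -> l1norm (W t) <=
    (`|M| / 2 ^+ m + 2 * (k * l)%:R * d) * expR (gronwall_rate k l L * (T - t)).
  elim: m => [|m IH] t tT.
    apply: le_trans (WM t tT) _; apply: (@le_trans _ _ `|M|); first exact: ler_norm.
    apply: (@le_trans _ _ (`|M| / 2 ^+ 0 + 2 * (k * l)%:R * d)).
      by rewrite expr0 divr1 lerDl !mulr_ge0.
    by rewrite ler_peMr ?ex1// addr_ge0 ?mulr_ge0// divr_ge0// exprn_ge0.
  set mm := (`|M| / 2 ^+ m + 2 * (k * l)%:R * d) in IH.
  have mm0 : 0 <= mm by rewrite addr_ge0 ?mulr_ge0// divr_ge0// exprn_ge0.
  have := @gronwall_step R k l T L mm d W dW L0 mm0 d0 WT Wd.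
  move=> /(_ _ t tT) H; apply: (le_trans (H _)).
    move=> s sT; apply: le_trans (dWb s sT) _; rewrite [leRHS]mulrDl lerD//.
      by rewrite -mulrA ler_wpM2l// IH.
    by rewrite ler_peMr// ex1.
  rewrite ler_wpM2r ?expR_ge0// /mm exprSr.
  rewrite le_eqVlt; apply/orP; left; apply/eqP; field.
  by rewrite expf_neq0.
move=> t tT; apply: le_trans (_ : 2 * (k * l)%:R * d * expR (gronwall_rate k l L * (T - t)) <= _).
  apply: (@le_halving _ _ (`|M| * expR (gronwall_rate k l L * (T - t)))) => m.
  by apply: le_trans (H m t tT) _; rewrite mulrDl mulrAC.
rewrite /gronwall_const [leRHS]mulrAC ler_wpM2l// ?mulr_ge0//.
rewrite ler_expR ler_wpM2l ?(ltW K0)//.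
by case/andP: tT => t0 _; rewrite gerBl.
Qed.

(** * Uniform limits *)

Definition unif_lim (R : realType) (k l : nat) (T : R)
    (Y : nat -> R -> 'M[R]_(k, l)) (y : R -> 'M[R]_(k, l)) : Prop :=
  forall e, 0 < e -> exists K : nat, forall m, (K <= m)%N ->
    forall t, 0 <= t <= T -> l1norm (Y m t - y t) <= e.

Lemma unif_lim_exists (R : realType) (k l : nat) (T : R)
    (Y : nat -> R -> 'M[R]_(k, l)) :
  (forall e, 0 < e -> exists K : nat, forall a b, (K <= a)%N -> (K <= b)%N ->
     forall t, 0 <= t <= T -> l1norm (Y a t - Y b t) <= e) ->
  exists y, unif_lim T Y y.
Proof.
move=> YC.
pose y t := \matrix_(i < k, j < l) limn (fun m => Y m t i j).
exists y => e e0.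
pose d := (k * l)%:R + 1 : R.
have d0 : 0 < d by rewrite /d ltr_wpDl.
have [K KP] := YC _ (divr_gt0 e0 d0); exists K => m Km t tT.
apply: (@le_trans _ _ ((k * l)%:R * (e / d))); last first.
  by rewrite mulrCA ler_piMr ?(ltW e0)// ler_pdivrMr// mul1r /d lerDl.
apply: l1norm_le => i j; rewrite !mxE.
have cv : cvgn (fun m => Y m t i j).
  apply/cauchy_cvgP; apply/cauchy_ballP => f f0; near_simpl.
  have f20 : 0 < f / 2 by rewrite divr_gt0.
  have [K' K'P] := YC _ f20.
  exists ([set a | (K' <= a)%N], [set a | (K' <= a)%N]) => /=.
    by split; exists K'.
  case=> a b [/= Ka Kb]; rewrite /ball/=.
  apply: (@le_lt_trans _ _ (f / 2)); last by lra.
  have := l1norm_entry (Y a t - Y b t) i j; rewrite !mxE => /le_trans; apply.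
  exact: K'P.
have : (fun b => Y m t i j - Y b t i j) @ \oo --> Y m t i j - limn (fun m => Y m t i j).
  by apply: cvgB => //; exact: cvg_cst.
move=> /cvg_norm cvN.
rewrite -(cvg_lim (@Rhausdorff R) cvN); apply: limr_le; first by apply/cvg_ex; eexists; exact: cvN.
exists K => // b /= Kb.
have := l1norm_entry (Y m t - Y b t) i j; rewrite !mxE => /le_trans; apply.
exact: KP.
Unshelve. all: by end_near. Qed.

Lemma unif_lim_bound (R : realType) (k l : nat) (T : R)
    (Y : nat -> R -> 'M[R]_(k, l)) y z (b : R) (t : R) :
  unif_lim T Y y -> 0 <= t <= T -> (forall m, l1norm (Y m t - z) <= b) ->
  l1norm (y t - z) <= b.
Proof.
move=> Yy tT Yb; apply/ler_addgt0Pr => e e0.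
have [K KP] := Yy e e0; have := KP K (leqnn _) t tT; rewrite l1norm_distC => H.
by rewrite [b + e]addrC; apply: le_trans (l1norm_distD (Y K t) _ _) _; rewrite lerD.
Qed.

(** Termwise differentiation: the mean value inequality for [Y a - Y b]
    controls the difference quotients uniformly, hence also those of
    [Y a - y]. *)
Lemma unif_lim_deriv (R : realType) (k l : nat) (T : R)
    (Y dY : nat -> R -> 'M[R]_(k, l)) (y dy : R -> 'M[R]_(k, l)) :
  (forall m t, 0 <= t <= T -> has_derivative_in T (Y m) t (dY m t)) ->
  unif_lim T Y y -> unif_lim T dY dy ->
  forall t, 0 <= t <= T -> has_derivative_in T y t (dy t).
Proof.
move=> Yd Yy dYy t tT; apply/has_derivative_inP => i j e e0.
have e40 : 0 < e / 4 by rewrite divr_gt0.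
have [K KP] := dYy _ e40.
have /has_derivative_inP/(_ i j) := Yd K t tT.
move=> /(_ _ e40)[h h0 hP]; exists h => // s sT st.
have E m x : 0 <= x <= T -> (K <= m)%N -> `|dY m x i j - dy x i j| <= e / 4.
  move=> xT Km; have := l1norm_entry (dY m x - dy x) i j; rewrite !mxE => /le_trans; apply.
  exact: KP.
have B m : (K <= m)%N ->
    `|(Y K s i j - Y m s i j) - (Y K t i j - Y m t i j)| <= e / 2 * `|s - t|.
  move=> Km.
  apply: (@deriv_on_lip R T (fun x => Y K x i j - Y m x i j)
    (fun x => dY K x i j - dY m x i j)) => //.
    move=> x xT; have /has_derivative_inP/(_ i j) := has_derivative_inB (Yd K x xT) (Yd m x xT).
    rewrite !mxE; congr deriv_on; apply/funext => r; by rewrite !mxE.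
  move=> x xT; have := E _ x xT Km; have := E _ x xT (leqnn K).
  rewrite !ler_norml => /andP[? ?] /andP[? ?]; apply/andP; split; lra.
have B' : `|(Y K s i j - y s i j) - (Y K t i j - y t i j)| <= e / 2 * `|s - t|.
  apply/ler_addgt0Pr => f f0.
  have f20 : 0 < f / 2 by rewrite divr_gt0.
  have [K' K'P] := Yy _ f20; pose m := maxn K K'.
  have D x : 0 <= x <= T -> `|Y m x i j - y x i j| <= f / 2.
    move=> xT; have := l1norm_entry (Y m x - y x) i j; rewrite !mxE => /le_trans; apply.
    by apply: K'P => //; exact: leq_maxr.
  have := B m (leq_maxl _ _); have := D _ sT; have := D _ tT.
  by rewrite !ler_norml => /andP[? ?] /andP[? ?] /andP[? ?]; apply/andP; split; lra.
have := hP s sT st; have := E _ t tT (leqnn K).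
move: B'.
have -> : y s i j - y t i j - (s - t) * dy t i j =
   (Y K s i j - Y K t i j - (s - t) * dY K t i j)
   - ((Y K s i j - y s i j) - (Y K t i j - y t i j))
   + (s - t) * (dY K t i j - dy t i j) by ring.
set p := (X in `|X| <= _ -> _); set q := dY _ _ _ _ - _; set r := (X in _ -> _ -> `|X| <= _ -> _).
move=> pb qb rb; apply: le_trans (ler_normD _ _) _.
have := ler_normB r p.
have : `|(s - t) * q| <= e / 4 * `|s - t| by rewrite normrM mulrC ler_wpM2r.
by move: pb rb; set N := `|s - t|; lra.
Qed.

(** * Solving differential equations near an approximate solution *)

Lemma is_derive_deriv_on (R : realType) (T : R) (f : R -> R) (t d : R) :
  is_derive t 1 f d -> deriv_on T f t d.
Proof.
move=> [fd <-] e e0.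
have /cvgrPdist_le/(_ e e0) : (fun h : R => h^-1 *: ((f \o shift t) (h *: (1:R)) - f t)) @ 0^' --> 'D_1 f t.
  exact: fd.
rewrite /= => /nbhs_ballP[h/= h0 hP]; exists h => // s sT st.
have [->|sNt] := eqVneq s t; first by rewrite !subrr mul0r subrr normr0 mulr0.
have st0 : s - t != 0 by rewrite subr_eq0.
have := hP (s - t); rewrite /ball/= sub0r normrN => /(_ st st0).
rewrite [_ *: 1]mulr1 subrK => le1.
have -> : f s - f t - (s - t) * 'D_1 f t =
   - (('D_1 f t - (s - t)^-1 * (f s - f t)) * (s - t)) by field.
by rewrite normrN normrM ler_wpM2r.
Qed.

(** Extending [f] by its end values makes it continuous on the whole line, so
    that the fundamental theorem of calculus applies at the end points too. *)
Lemma cont_on_antiderivative (R : realType) (T : R) (f : R -> R) (c : R) :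
  0 < T -> cont_on T f ->
  exists F : R -> R, F T = c /\ forall t, 0 <= t <= T -> deriv_on T F t (f t).
Proof.
move=> T0 fc.
pose clamp (s : R) := Num.max 0 (Num.min s T).
have clampT s : 0 <= clamp s <= T.
  by rewrite /clamp le_max lexx /= ge_max ge_min lexx orbT ltW.
have clamp_id s : 0 <= s <= T -> clamp s = s.
  by move=> /andP[s0 sT]; rewrite /clamp min_l// max_r.
have clamp_lip s t : `|clamp s - clamp t| <= `|s - t|.
  have := ler_norm (s - t); have := ler_norm (t - s); rewrite distrC.
  move: `|s - t| => N N1 N2; rewrite /clamp ler_norml.
  case: (leP s T) => ?; case: (leP t T) => ?; rewrite ?(max_r (ltW T0));
    case: (leP 0 s) => ?; case: (leP 0 t) => ?; apply/andP; split; lra.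
pose g := f \o clamp.
have gc : continuous (g : R -> R^o).
  move=> x; apply/cvgrPdist_le => e e0.
  have [h h0 hP] := fc (clamp x) (clampT x) e e0.
  apply/nbhs_ballP; exists h => //= y; rewrite /ball/= distrC => xy.
  by rewrite distrC /g; apply: hP => //; exact: le_lt_trans (clamp_lip _ _) xy.
(* integration over [-1, T + 1] keeps 0 and T in the interior *)
pose u := T + 1; pose m := @lebesgue_measure R.
have gi : m.-integrable `[-1, u] (EFin \o g).
  apply: continuous_compact_integrable; first exact: segment_compact.
  by apply: continuous_subspaceT => x; exact: gc.
pose F (x : R) := (\int[m]_(s in `[(-1)%R, x]) g s)%R.
exists (fun x => F x - F T + c); split; first by rewrite subrr add0r.
move=> t tT.
have tu : t < u by rewrite /u; case/andP: tT => ? ?; lra.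
have mt : -1 < t by case/andP: tT => ? ?; lra.
have [d1 d2] := @continuous_FTC1_closed R g (-1) t u tu gi mt (gc t).
apply: is_derive_deriv_on.
have Fd : is_derive t 1 F (f t).
  by apply: DeriveDef => //; rewrite -derive1E d2 /g /= clamp_id.
have -> : (fun x => F x - F T + c) = F + (cst (- F T + c)).
  by apply/funext => x; rewrite -addrA.
rewrite -[X in is_derive _ _ _ X]addr0; apply: is_deriveD.
Qed.

(** Picard iteration around an approximate solution [y0] with defect [d].
    The increments form a geometric series of ratio one half, whose sum is at
    most [gronwall_const] times [d]; hence no iterate leaves the tube of radius
    [r], where [Phi] is Lipschitz. *)
Lemma picard_near (R : realType) (k l : nat) (T L r d : R)
    (G : 'M[R]_(k, l) -> Prop) (Phi : 'M[R]_(k, l) -> 'M[R]_(k, l))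
    (y0 d0 : R -> 'M[R]_(k, l)) :
  0 < T -> 0 <= L -> 0 <= d -> gronwall_const k l T L * d <= r ->
  (forall t, 0 <= t <= T -> has_derivative_in T y0 t (d0 t)) ->
  (forall t Y, 0 <= t <= T -> l1norm (Y - y0 t) <= r -> G Y) ->
  (forall Y Z, G Y -> G Z -> l1norm (Phi Y - Phi Z) <= L * l1norm (Y - Z)) ->
  (forall t, 0 <= t <= T -> l1norm (Phi (y0 t) - d0 t) <= d) ->
  exists y, [/\ y T = y0 T,
    forall t, 0 <= t <= T -> has_derivative_in T y t (Phi (y t)) &
    forall t, 0 <= t <= T -> l1norm (y t - y0 t) <= gronwall_const k l T L * d].
Proof.
move=> T0 L0 dd0 dr y0d tubeG PhiL defect.
pose K := gronwall_rate k l L; have K0 : 0 < K := gronwall_rate_gt0 k l L0.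
pose w t := expR (K * (T - t)).
have w1 t : 0 <= t <= T -> 1 <= w t.
  move=> /andP[t0 tT]; rewrite /w -(@expR0 R) ler_expR mulr_ge0 ?(ltW K0)//.
  by rewrite subr_ge0.
have wT t : 0 <= t <= T -> w t <= expR (K * T).
  by move=> /andP[t0 tT]; rewrite /w ler_expR ler_wpM2l ?(ltW K0)// gerBl.
have w0 t : 0 <= w t by exact: expR_ge0.
pose b := (k * l)%:R * d; have b0 : 0 <= b by rewrite mulr_ge0.
(* [Phi] can be composed with [Y] and integrated as long as [Y] satisfies [ok] *)
pose ok (Y : R -> 'M[R]_(k, l)) := cont_mx T Y /\
  forall t, 0 <= t <= T -> G (Y t).
have step_ex Y : exists Z : R -> 'M[R]_(k, l), ok Y -> Z T = y0 T /\
    forall t, 0 <= t <= T -> has_derivative_in T Z t (Phi (Y t)).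
  have [[Yc YG]|nok] := pselect (ok Y); last by exists Y.
  have Phic : cont_mx T (fun s => Phi (Y s)).
    move=> t tT e e0; have L1 : 0 < L + 1 by rewrite ltr_wpDl.
    have [h h0 hP] := Yc t tT _ (divr_gt0 e0 L1); exists h => // s sT st.
    apply: le_trans (PhiL _ _ (YG _ sT) (YG _ tT)) _.
    apply: (@le_trans _ _ (L * (e / (L + 1)))); first by rewrite ler_wpM2l// hP.
    by rewrite mulrCA ler_piMr ?(ltW e0)// ler_pdivrMr// mul1r lerDl.
  have H i : forall j, exists F : R -> R, F T = y0 T i j /\
      forall t, 0 <= t <= T -> deriv_on T F t (Phi (Y t) i j).
    by move=> j; apply: cont_on_antiderivative => //; exact: cont_mx_entry.
  have /choice[F FP] : forall ij : 'I_k * 'I_l, exists F : R -> R,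
      F T = y0 T ij.1 ij.2 /\
      forall t, 0 <= t <= T -> deriv_on T F t (Phi (Y t) ij.1 ij.2).
    by move=> ij; exact: H.
  exists (fun s => \matrix_(i, j) F (i, j) s) => _; split.
    by apply/matrixP => i j; rewrite mxE; have [] := FP (i, j).
  move=> t tT; apply/has_derivative_inP => i j.
  have -> : (fun s => (\matrix_(i, j) F (i, j) s) i j) = F (i, j).
    by apply/funext => s; rewrite mxE.
  by have [_] := FP (i, j); exact.
have [step stepP] := choice step_ex.
pose Y m := iter m step y0.
have tube_ok m : cont_mx T (Y m) ->
    (forall t, 0 <= t <= T -> l1norm (Y m t - y0 t) <= 2 * b * w t) -> ok (Y m).
  move=> Yc Yb; split=> // t tT; apply: (tubeG t) => //.
  apply: le_trans (Yb t tT) _; apply: le_trans dr.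
  rewrite /b /gronwall_const !mulrA [leRHS]mulrAC ler_wpM2l ?mulr_ge0//.
  exact: wT.
have inv m : [/\ ok (Y m),
    forall t, 0 <= t <= T -> l1norm (Y m t - y0 t) <= 2 * b * (1 - 2^-1 ^+ m) * w t &
    forall t, 0 <= t <= T -> l1norm (Y m.+1 t - Y m t) <= b * 2^-1 ^+ m * w t].
  elim: m => [|m [okm IH1 IH2]].
    have ok0 : ok y0.
      split; first exact: has_derivative_in_cont y0d.
      move=> t tT; apply: (tubeG t) => //; rewrite subrr l1norm0.
      by apply: le_trans dr; rewrite mulr_ge0// gronwall_const_ge0.
    split => //.
      by move=> t tT; rewrite subrr l1norm0 expr0 subrr mulr0 mul0r.
    move=> t tT /=; have [Y1T Y1d] := stepP _ ok0.
    have := @gronwall_step R k l T L 0 d (fun s => step y0 s - y0 s)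
      (fun s => Phi (y0 s) - d0 s) L0 (lexx _) dd0.
    rewrite Y1T subrr => /(_ erefl) H; rewrite expr0 mulr1.
    have := H _ _ t tT; rewrite mul0r add0r; apply.
      by move=> x xT; apply: has_derivative_inB; [exact: Y1d|exact: y0d].
    move=> x xT; rewrite mulr0 add0r; apply: le_trans (defect x xT) _.
    by rewrite ler_peMr// w1.
  have [YT Yd] := stepP _ okm.
  have bnd t : 0 <= t <= T ->
      l1norm (Y m.+1 t - y0 t) <= 2 * b * (1 - 2^-1 ^+ m.+1) * w t.
    move=> tT; apply: le_trans (l1norm_distD (Y m t) _ _) _.
    have -> : 2 * b * (1 - 2^-1 ^+ m.+1) * w t =
        b * 2^-1 ^+ m * w t + 2 * b * (1 - 2^-1 ^+ m) * w t.
      by rewrite exprSr; field.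
    by rewrite lerD ?IH1 ?IH2.
  have okm1 : ok (Y m.+1).
    apply: tube_ok; first exact: has_derivative_in_cont Yd.
    move=> t tT; apply: le_trans (bnd t tT) _; rewrite ler_wpM2r//.
    by rewrite ler_piMr ?mulr_ge0// gerBl exprn_ge0// invr_ge0.
  split => // t tT.
  have [YT' Yd'] := stepP _ okm1.
  have m0 : 0 <= b * 2^-1 ^+ m by rewrite mulr_ge0// exprn_ge0// invr_ge0.
  have := @gronwall_step R k l T L (b * 2^-1 ^+ m) 0
    (fun s => Y m.+2 s - Y m.+1 s)
    (fun s => Phi (Y m.+1 s) - Phi (Y m s)) L0 m0 (lexx _).
  rewrite [Y m.+2 T]YT' [Y m.+1 T]YT subrr => /(_ erefl) H.
  have -> : b * 2^-1 ^+ m.+1 = b * 2^-1 ^+ m / 2 by rewrite exprSr mulrA.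
  have := H _ _ t tT; rewrite mulr0 !addr0; apply.
    by move=> x xT; apply: has_derivative_inB; [exact: Yd'|exact: Yd].
  move=> x xT; rewrite -mulrA.
  apply: le_trans (PhiL _ _ (okm1.2 x xT) (okm.2 x xT)) _.
  by rewrite ler_wpM2l// IH2.
have okY m : ok (Y m) by have [] := inv m.
have YY m p t : 0 <= t <= T ->
    l1norm (Y (m + p)%N t - Y m t) <= 2 * b * expR (K * T) * 2^-1 ^+ m.
  move=> tT.
  have : l1norm (Y (m + p)%N t - Y m t) <= 2 * b * (1 - 2^-1 ^+ p) * 2^-1 ^+ m * w t.
    elim: p => [|p IH]; first by rewrite addn0 subrr l1norm0 expr0 subrr mulr0 !mul0r.
    apply: le_trans (l1norm_distD (Y (m + p)%N t) _ _) _.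
    have -> : 2 * b * (1 - 2^-1 ^+ p.+1) * 2^-1 ^+ m * w t =
       b * 2^-1 ^+ (m + p) * w t + 2 * b * (1 - 2^-1 ^+ p) * 2^-1 ^+ m * w t.
      by rewrite exprSr exprD; field.
    by rewrite lerD// addnS; have [_ _] := inv (m + p)%N; exact.
  move=> /le_trans; apply; rewrite [leRHS]mulrAC.
  have h0 : 0 <= 2^-1 ^+ m :> R by rewrite exprn_ge0// invr_ge0.
  apply: ler_pM => //; last exact: wT.
    by rewrite !mulr_ge0// subr_ge0 exprn_ile1// ?invr_ge0// invf_le1// ler1n.
  by rewrite ler_wpM2r// ler_piMr ?mulr_ge0// gerBl exprn_ge0// invr_ge0.
have small e : 0 < e -> exists M : nat, forall m p t, (M <= m)%N -> 0 <= t <= T ->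
    l1norm (Y (m + p)%N t - Y m t) <= e.
  move=> e0; pose c := 2 * b * expR (K * T).
  have c0 : 0 <= c by rewrite !mulr_ge0// expR_ge0.
  exists (Num.trunc (c / e)).+1 => m p t mM tT; apply: le_trans (YY m p t tT) _.
  rewrite -/c exprVn ler_pdivrMr ?exprn_gt0// mulrC -ler_pdivrMr//.
  apply: (@le_trans _ _ m%:R).
    by apply: le_trans (ltW (truncnS_gt _)) _; rewrite ler_nat.
  by rewrite -natrX ler_nat ltnW// ltn_expl.
have [y Yy] : exists y, unif_lim T Y y.
  apply: unif_lim_exists => e e0.
  have [M MP] := small _ e0; exists M => a a'.
  wlog aa' : a a' / (a <= a')%N => [W|].
    case/orP: (leq_total a a') => aa'; first exact: W.
    by move=> Ma Ma' t tT; rewrite l1norm_distC; exact: W.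
  move=> Ma Ma' t tT; rewrite l1norm_distC -(subnKC aa'); exact: MP.
have yb t : 0 <= t <= T -> l1norm (y t - y0 t) <= gronwall_const k l T L * d.
  move=> tT; apply: (unif_lim_bound Yy tT) => m.
  have [_ /(_ t tT) H _] := inv m; apply: le_trans H _.
  rewrite /gronwall_const -!mulrA !ler_wpM2l//.
  rewrite [leRHS]mulrC ler_wpM2l//.
  have h0 : 0 <= 2^-1 ^+ m :> R by rewrite exprn_ge0// invr_ge0.
  have h1 : 2^-1 ^+ m <= 1 :> R by rewrite exprn_ile1// ?invr_ge0// invf_le1// ler1n.
  rewrite -[leRHS]mul1r; apply: ler_pM; rewrite ?wT//; first by rewrite subr_ge0.
have yG t : 0 <= t <= T -> G (y t).
  by move=> tT; apply: (tubeG t) => //; exact: le_trans (yb t tT) dr.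
have YT m : Y m T = y0 T by case: m => [//|m]; have [] := stepP _ (okY m).
have yT : y T = y0 T.
  apply/eqP; rewrite -subr_eq0; apply/eqP/l1norm_le0.
  apply: (unif_lim_bound Yy); first by rewrite lexx ltW.
  by move=> m; rewrite YT subrr l1norm0.
exists y; split => //.
apply: (@unif_lim_deriv R k l T (fun m => Y m.+1) (fun m t => Phi (Y m t))).
- by move=> m t tT; have [_] := stepP _ (okY m); exact.
- move=> e e0; have [M MP] := Yy e e0; exists M => m Mm; apply: MP.
  exact: leqW.
- move=> e e0.
  have L1 : 0 < L + 1 by rewrite ltr_wpDl.
  have [M MP] := Yy _ (divr_gt0 e0 L1); exists M => m Mm t tT.
  apply: le_trans (PhiL _ _ ((okY m).2 t tT) (yG t tT)) _.
  apply: (@le_trans _ _ (L * (e / (L + 1)))); first by rewrite ler_wpM2l// MP.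
  by rewrite mulrCA ler_piMr ?(ltW e0)// ler_pdivrMr// mul1r lerDl.
Qed.

(** * Coercive matrices *)

(** Symmetry is not part of the definition, so that Lipschitz estimates apply
    to matrices that are only known to be symmetric afterwards. *)
Definition coercive (R : realType) (k : nat) (c : R) (M : 'M[R]_k) : Prop :=
  forall x : 'cV[R]_k, c * (x^T *m x) 0 0 <= (x^T *m M *m x) 0 0.

Lemma sqnormE (R : realType) (k : nat) (x : 'cV[R]_k) :
  (x^T *m x) 0 0 = \sum_i x i 0 ^+ 2.
Proof. by rewrite mxE; apply: eq_bigr => i _; rewrite mxE expr2. Qed.

Lemma sqnorm_ge0 (R : realType) (k : nat) (x : 'cV[R]_k) : 0 <= (x^T *m x) 0 0.
Proof. by rewrite sqnormE sumr_ge0// => i _; rewrite sqr_ge0. Qed.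

Lemma sqnorm_entry (R : realType) (k : nat) (x : 'cV[R]_k) i :
  x i 0 ^+ 2 <= (x^T *m x) 0 0.
Proof.
by rewrite sqnormE (bigD1 i)//= lerDl sumr_ge0// => j _; rewrite sqr_ge0.
Qed.

Lemma sqnorm_gt0 (R : realType) (k : nat) (x : 'cV[R]_k) :
  x != 0 -> 0 < (x^T *m x) 0 0.
Proof.
move=> /cV0Pn[i xi]; apply: lt_le_trans (sqnorm_entry x i).
by rewrite lt_neqAle sqr_ge0 eq_sym sqrf_eq0 xi.
Qed.

Lemma quad_form_le (R : realType) (k : nat) (M : 'M[R]_k) (x : 'cV[R]_k) :
  `|(x^T *m M *m x) 0 0| <= l1norm M * (x^T *m x) 0 0.
Proof.
rewrite mxE; apply: le_trans (ler_norm_sum _ _ _) _.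
rewrite /l1norm exchange_big mulr_suml /=; apply: ler_sum => j _.
rewrite mxE mulr_suml mulr_suml; apply: le_trans (ler_norm_sum _ _ _) _.
apply: ler_sum => i _; rewrite mxE !normrM mulrAC mulrC ler_wpM2l//.
have := sqnorm_entry x i; have := sqnorm_entry x j.
rewrite -(real_normK (num_real (x i 0))) -(real_normK (num_real (x j 0))).
have := sqr_ge0 (`|x i 0| - `|x j 0|).
by move: `|x i 0| `|x j 0| => a b; rewrite sqrrB; lra.
Qed.

Lemma quad_formB (R : realType) (k : nat) (M M' : 'M[R]_k) (x : 'cV[R]_k) :
  (x^T *m (M' - M) *m x) 0 0 = (x^T *m M' *m x) 0 0 - (x^T *m M *m x) 0 0.
Proof. by rewrite mulmxBr mulmxBl [LHS]mxE [X in _ + X]mxE. Qed.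

Lemma coercive_perturb (R : realType) (k : nat) (c c' : R) (M M' : 'M[R]_k) :
  coercive c M -> l1norm (M' - M) <= c - c' -> coercive c' M'.
Proof.
move=> Mc MM x; have := quad_form_le (M' - M) x; have := Mc x.
have : l1norm (M' - M) * (x^T *m x) 0 0 <= (c - c') * (x^T *m x) 0 0.
  by rewrite ler_wpM2r// sqnorm_ge0.
by rewrite quad_formB ler_norml mulrBl => H1 H2 /andP[H3 _]; lra.
Qed.

Lemma coercive_tr (R : realType) (k : nat) (c : R) (M : 'M[R]_k) :
  coercive c M -> coercive c M^T.
Proof.
move=> Mc x.
have -> : x^T *m M^T *m x = (x^T *m M *m x)^T by rewrite !trmx_mul trmxK mulmxA.
by rewrite [leRHS]mxE; exact: Mc.
Qed.

Lemma coercive_closed (R : realType) (k : nat) (c : R) (M : 'M[R]_k) :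
  (forall e, 0 < e -> exists M', coercive c M' /\ l1norm (M - M') <= e) ->
  coercive c M.
Proof.
move=> H x; apply/ler_addgt0Pr => e e0.
pose q := (x^T *m x) 0 0; have q0 : 0 <= q by exact: sqnorm_ge0.
have q1 : 0 < q + 1 by rewrite ltr_wpDl.
have [M' [M'c MM]] := H _ (divr_gt0 e0 q1).
have : coercive (c - e / (q + 1)) M.
  by apply: coercive_perturb M'c _; rewrite opprB addrCA subrr addr0.
move=> /(_ x); rewrite -/q mulrBl -lerBlDr; apply: le_trans; rewrite lerB//.
by rewrite mulrAC ler_pdivrMr// ler_wpM2l ?(ltW e0)// lerDl.
Qed.

Lemma loewner_scalarP (R : realType) (k : nat) (c : R) (M : 'M[R]_k) :
  loewner_le c%:M M <-> symmx M /\ coercive c M.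
Proof.
have E (x : 'cV[R]_k) : (x^T *m (M - c%:M) *m x) 0 0 =
    (x^T *m M *m x) 0 0 - c * (x^T *m x) 0 0.
  by rewrite quad_formB mul_mx_scalar -scalemxAl [X in _ - X]mxE.
rewrite /loewner_le /possemidefmx /symmx linearB/= tr_scalar_mx; split.
  move=> [MT Mc]; split; first by apply: (addIr (- c%:M)).
  by move=> x; rewrite -subr_ge0 -E.
move=> [-> Mc]; split => // x; rewrite E subr_ge0; exact: Mc.
Qed.

Lemma coercive_posdef (R : realType) (k : nat) (c : R) (M : 'M[R]_k) :
  0 < c -> symmx M -> coercive c M -> posdefmx M.
Proof.
move=> c0 MT Mc; split=> // x x0; apply: lt_le_trans (Mc x).
by rewrite mulr_gt0// sqnorm_gt0.
Qed.

Lemma definite_unitmx (R : realType) (k : nat) (M : 'M[R]_k) :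
  (forall x : 'cV[R]_k, x != 0 -> 0 < (x^T *m M *m x) 0 0) -> M \in unitmx.
Proof.
move=> Mpos; rewrite -row_free_unit -kermx_eq0; apply/rowV0P => v /sub_kermxP vM.
apply/eqP/negP => /negP v0.
have := Mpos v^T; rewrite trmxK vM mul0mx mxE ltxx => H.
have : false by apply: H; rewrite -trmx0 (inj_eq trmx_inj).
by [].
Qed.

Lemma coercive_unitmx (R : realType) (k : nat) (c : R) (M : 'M[R]_k) :
  0 < c -> coercive c M -> M \in unitmx.
Proof.
move=> c0 Mc; apply: definite_unitmx => x x0; apply: lt_le_trans (Mc x).
by rewrite mulr_gt0// sqnorm_gt0.
Qed.

(** Testing coercivity on [x = M^-1 e_j] gives [c |x|^2 <= x_j], which bounds
    first [x_j] and then every entry of [x] by [c^-1]. *)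
Lemma coercive_invmx_le (R : realType) (k : nat) (c : R) (M : 'M[R]_k) :
  0 < c -> coercive c M -> l1norm (invmx M) <= (k * k)%:R * c^-1.
Proof.
move=> c0 Mc; have Mu := coercive_unitmx c0 Mc.
apply: l1norm_le => i j.
pose x := col j (invmx M).
have Mx : M *m x = delta_mx j 0 by rewrite /x colE mulmxA mulmxV// mul1mx.
have q : (x^T *m M *m x) 0 0 = x j 0.
  rewrite -mulmxA Mx mxE (bigD1 j)//= big1 ?addr0; last first.
    by move=> h hj; rewrite [X in _ * X]mxE (negbTE hj) mulr0.
  by rewrite [X in _ * X]mxE !eqxx mulr1 mxE.
have H h : c * x h 0 ^+ 2 <= x j 0.
  rewrite -q; apply: le_trans (Mc x); rewrite ler_wpM2l ?(ltW c0)//.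
  exact: sqnorm_entry.
have ci : 0 < c^-1 by rewrite invr_gt0.
have xj0 : 0 <= x j 0 by apply: le_trans (H j); rewrite mulr_ge0 ?(ltW c0)// sqr_ge0.
have xj : x j 0 <= c^-1.
  have [->|xjn] := eqVneq (x j 0) 0; first exact: ltW.
  have xjp : 0 < x j 0 by rewrite lt_neqAle eq_sym xjn.
  by have := H j; rewrite expr2 mulrA ger_pMl// mulrC -ler_pdivlMr// div1r.
have : x i 0 ^+ 2 <= c^-1 ^+ 2.
  rewrite expr2 -[leRHS]mulr1 -(@mulVf _ c) ?gt_eqF// -expr2.
  have h2 := le_trans (H i) xj.
  rewrite -(ler_pM2l c0); apply: le_trans h2 _.
  by rewrite le_eqVlt; apply/orP; left; apply/eqP; field; rewrite gt_eqF.
rewrite -[x i 0 ^+ 2](real_normK (num_real _)) ler_sqr ?nnegrE ?(ltW ci)//.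
by rewrite /x mxE.
Qed.

(** Minimizing the quadratic form along [x - s M^-1 x] turns a bound on the
    inverse into a lower bound on the form. *)
Lemma posdef_coercive (R : realType) (k : nat) (M : 'M[R]_k) :
  posdefmx M -> exists2 c, 0 < c & coercive c M.
Proof.
move=> [MT Mpos]; have Mu := definite_unitmx Mpos.
pose K := l1norm (invmx M) + 1; have K0 : 0 < K by rewrite ltr_wpDl// l1norm_ge0.
exists K^-1; first by rewrite invr_gt0.
move=> x; pose y := invmx M *m x; pose s := K^-1.
have My : M *m y = x by rewrite /y mulmxA mulmxV// mul1mx.
have yM : y^T *m M = x^T by rewrite -[in LHS]MT -trmx_mul My.
have q0 (z : 'cV[R]_k) : 0 <= (z^T *m M *m z) 0 0.
  have [->|z0] := eqVneq z 0; first by rewrite mulmx0 mxE.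
  by apply: ltW; exact: Mpos.
have := q0 (x - s *: y).
have -> : (x - s *: y)^T *m M *m (x - s *: y) =
    x^T *m M *m x - (2 * s) *: (x^T *m x) + s ^+ 2 *: (x^T *m invmx M *m x).
  have -> : (x - s *: y)^T = x^T - s *: y^T by apply/matrixP => i j; rewrite !mxE.
  rewrite !(mulmxBl, mulmxBr) -!(scalemxAl, scalemxAr) yM.
  have -> : x^T *m M *m y = x^T *m x by rewrite -mulmxA My.
  have -> : x^T *m y = x^T *m invmx M *m x by rewrite mulmxA.
  move: (x^T *m M *m x) (x^T *m x) (x^T *m invmx M *m x) => q1 q2 q3.
  by apply/matrixP => i j; rewrite !mxE; ring.
have E (P1 P2 P3 : 'M[R]_1) : (P1 - (2 * s) *: P2 + s ^+ 2 *: P3) 0 0 =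
    P1 0 0 - 2 * s * P2 0 0 + s ^+ 2 * P3 0 0 by rewrite !mxE.
rewrite E.
have := quad_form_le (invmx M) x; rewrite ler_norml => /andP[_ H].
set q := (x^T *m M *m x) 0 0; set n := (x^T *m x) 0 0 in H *.
set r := (x^T *m invmx M *m x) 0 0 in H *.
have n0 : 0 <= n by exact: sqnorm_ge0.
have : s ^+ 2 * r <= s * n.
  rewrite expr2 -mulrA ler_wpM2l ?invr_ge0 ?(ltW K0)//.
  rewrite /s mulrC ler_pdivrMr//; apply: le_trans H _.
  by rewrite mulrC ler_wpM2l// /K lerDl.
by rewrite -/s; lra.
Qed.

(** By perturbation every time has a neighbourhood with a common constant;
    finitely many of them cover the interval. *)
Lemma coercive_uniform (R : realType) (T : R) (k : nat) (M : R -> 'M[R]_k) :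
  cont_mx T M -> (forall t, 0 <= t <= T -> posdefmx (M t)) ->
  exists2 c, 0 < c & forall t, 0 <= t <= T -> coercive c (M t).
Proof.
move=> Mc Mpos.
have /compact_near_coveringP/near_covering_withinP Tc := @segment_compact R 0 T.
have H : \forall c \near (0 : R)^'+,
    `[0, T] `<=` (fun t => 0 <= t <= T -> coercive c (M t)).
  apply: Tc => t; rewrite /= in_itv/= => tT.
  have [c c0 cM] := posdef_coercive (Mpos t tT).
  have c20 : 0 < c / 2 by rewrite divr_gt0.
  have [h h0 hP] := Mc t tT _ c20.
  exists ([set s | `|s - t| < h], [set c' | c' <= c / 2]) => /=.
    split; last exact: nbhs_right_le.
    by apply/nbhs_ballP; exists h => //= s; rewrite /ball/= distrC.
  case=> s c' [/= st cc'] _ sT.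
  apply: coercive_perturb cM _; apply: le_trans (hP s sT st) _; lra.
near ((0 : R)^'+) => c; exists c; first by near: c; exact: nbhs_right_gt.
move=> t tT; apply: (near H c) => //=.
Unshelve. all: by end_near. Qed.

Lemma cont_mx_bounded (R : realType) (T : R) (k l : nat) (Y : R -> 'M[R]_(k, l)) :
  cont_mx T Y ->
  exists2 C, 0 <= C & forall t, 0 <= t <= T -> l1norm (Y t) <= C.
Proof.
move=> Yc.
have /compact_near_coveringP/near_covering_withinP Tc := @segment_compact R 0 T.
have H : \forall C \near +oo,
    `[0, T] `<=` (fun t => 0 <= t <= T -> l1norm (Y t) <= C).
  apply: Tc => t; rewrite /= in_itv/= => tT.
  have [h h0 hP] := Yc t tT _ ltr01.
  exists ([set s | `|s - t| < h], [set C | l1norm (Y t) + 1 <= C]) => /=.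
    split; last exact: nbhs_pinfty_ge (num_real _).
    by apply/nbhs_ballP; exists h => //= s; rewrite /ball/= distrC.
  case=> s C [/= st CC] _ sT; apply: le_trans CC.
  have -> : Y s = Y t + (Y s - Y t) by rewrite addrC subrK.
  by apply: le_trans (l1normD _ _) _; rewrite lerD2l hP.
near (+oo : set_system R) => C; exists C.
  by near: C; apply: nbhs_pinfty_ge (num_real _).
by move=> t tT; apply: (near H C) => //=; rewrite in_itv.
Unshelve. all: by end_near. Qed.

(** * The Riccati vector field *)

Definition ric (R : realType) (n m : nat) (B : 'M[R]_(n, m)) (A Q : 'M[R]_n)
    (X : 'M[R]_n) (W : 'M[R]_m) : 'M[R]_n :=
  X *m B *m invmx W *m B^T *m X - X *m A - A^T *m X - Q.

Lemma l1normM_le (R : realType) (k l m : nat) (a b : R) (Y : 'M[R]_(k, l))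
    (Z : 'M[R]_(l, m)) :
  l1norm Y <= a -> l1norm Z <= b -> l1norm (Y *m Z) <= a * b.
Proof.
move=> Ya Zb; apply: le_trans (l1normM _ _) _; apply: ler_pM => //; exact: l1norm_ge0.
Qed.

(** The inverse of a coercive weight is bounded, and differences of inverses
    are controlled by W^-1 - W'^-1 = W^-1 (W' - W) W'^-1. *)
Lemma ric_lip (R : realType) (n m : nat) (B : 'M[R]_(n, m)) (A : 'M[R]_n)
    (c C : R) :
  0 < c -> 0 <= C ->
  exists2 L, 0 <= L & forall (Q X X' : 'M[R]_n) (W W' : 'M[R]_m),
    l1norm X <= C -> l1norm X' <= C -> coercive c W -> coercive c W' ->
    l1norm (ric B A Q X W - ric B A Q X' W') <=
      L * (l1norm (X - X') + l1norm (W - W')).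
Proof.
move=> c0 C0.
pose a := l1norm A; pose b := l1norm B.
have a0 : 0 <= a := l1norm_ge0 _; have b0 : 0 <= b := l1norm_ge0 _.
have [r r0 rP] : exists2 r : R, 0 <= r &
    forall W : 'M[R]_m, coercive c W -> l1norm (invmx W) <= r.
  exists ((m * m)%:R * c^-1); first by rewrite mulr_ge0// invr_ge0 ltW.
  by move=> W; exact: coercive_invmx_le.
pose L1 := 2 * (b * r * b * C) + 2 * a; pose L2 := C * b * (r * r) * b * C.
have L10 : 0 <= L1 by rewrite /L1 addr_ge0// !mulr_ge0.
have L20 : 0 <= L2 by rewrite /L2 !mulr_ge0.
exists (L1 + L2); first by rewrite addr_ge0.
move=> Q X X' W W' XC XC' Wc Wc'.
have Wu := coercive_unitmx c0 Wc; have Wu' := coercive_unitmx c0 Wc'.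
have Wr : l1norm (invmx W) <= r := rP _ Wc.
have Wr' : l1norm (invmx W') <= r := rP _ Wc'.
have Winv : invmx W - invmx W' = invmx W *m (W' - W) *m invmx W'.
  by rewrite mulmxBr mulmxBl mulVmx// mul1mx mulmxK.
have -> : ric B A Q X W - ric B A Q X' W' =
    (X - X') *m B *m invmx W *m B^T *m X
    + X' *m B *m (invmx W - invmx W') *m B^T *m X
    + X' *m B *m invmx W' *m B^T *m (X - X')
    - (X - X') *m A - A^T *m (X - X').
  rewrite /ric !(mulmxBl, mulmxBr).
  by apply/matrixP => i j; rewrite !mxE; ring.
set dX := l1norm (X - X'); set dW := l1norm (W - W').
have dX0 : 0 <= dX := l1norm_ge0 _; have dW0 : 0 <= dW := l1norm_ge0 _.
have H1 : l1norm ((X - X') *m B *m invmx W *m B^T *m X) <= dX * b * r * b * C.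
  by rewrite !l1normM_le// l1norm_tr.
have H2 : l1norm (X' *m B *m (invmx W - invmx W') *m B^T *m X) <=
    C * b * (r * dW * r) * b * C.
  rewrite Winv; apply: l1normM_le => //; apply: l1normM_le; last by rewrite l1norm_tr.
  apply: l1normM_le; first exact: l1normM_le.
  by apply: l1normM_le => //; apply: l1normM_le => //; rewrite l1norm_distC.
have H3 : l1norm (X' *m B *m invmx W' *m B^T *m (X - X')) <= C * b * r * b * dX.
  by rewrite !l1normM_le// l1norm_tr.
have H4 : l1norm ((X - X') *m A) <= dX * a by exact: l1normM_le.
have H5 : l1norm (A^T *m (X - X')) <= a * dX by rewrite l1normM_le// l1norm_tr.
apply: le_trans (l1normB _ _) _.
apply: le_trans (lerD (l1normB _ _) (lexx _)) _.
apply: le_trans (lerD (lerD (l1normD _ _) (lexx _)) (lexx _)) _.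
apply: le_trans (lerD (lerD (lerD (l1normD _ _) (lexx _)) (lexx _)) (lexx _)) _.
have -> : (L1 + L2) * (dX + dW) = dX * b * r * b * C + C * b * (r * dW * r) * b * C
   + C * b * r * b * dX + dX * a + a * dX + (L1 * dW + L2 * dX).
  by rewrite /L1 /L2; ring.
apply: ler_wpDr; first by rewrite addr_ge0// mulr_ge0.
by rewrite !lerD.
Qed.

Lemma tr_ric (R : realType) (n m : nat) (B : 'M[R]_(n, m)) (A Q : 'M[R]_n)
    (X : 'M[R]_n) (W : 'M[R]_m) :
  symmx Q -> (ric B A Q X W)^T = ric B A Q X^T W^T.
Proof.
move=> QT; rewrite /ric !linearB/= !trmx_mul !trmxK trmx_inv QT !mulmxA.
by rewrite -!addrA; congr (_ + _); rewrite addrCA.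
Qed.

(** * Exchangeable block matrices *)

Lemma tensmxDl (R : realType) (m n p q : nat) (F G : 'M[R]_(m, n))
  (U : 'M[R]_(p, q)) : (F + G) *t U = F *t U + G *t U.
Proof. by apply/matrixP => i j; rewrite !mxE mulrDl. Qed.

Lemma tensmxBl (R : realType) (m n p q : nat) (F G : 'M[R]_(m, n))
  (U : 'M[R]_(p, q)) : (F - G) *t U = F *t U - G *t U.
Proof. by apply/matrixP => i j; rewrite !mxE mulrBl. Qed.

Lemma tensmxDr (R : realType) (m n p q : nat) (F : 'M[R]_(m, n))
  (U V : 'M[R]_(p, q)) : F *t (U + V) = F *t U + F *t V.
Proof. by apply/matrixP => i j; rewrite !mxE mulrDr. Qed.

Lemma tensmxBr (R : realType) (m n p q : nat) (F : 'M[R]_(m, n))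
  (U V : 'M[R]_(p, q)) : F *t (U - V) = F *t U - F *t V.
Proof. by apply/matrixP => i j; rewrite !mxE mulrBr. Qed.

Lemma tensmxZl (R : realType) (m n p q : nat) (a : R) (F : 'M[R]_(m, n))
  (U : 'M[R]_(p, q)) : (a *: F) *t U = a *: (F *t U).
Proof. by apply/matrixP => i j; rewrite !mxE mulrA. Qed.

Lemma tensmxZr (R : realType) (m n p q : nat) (a : R) (F : 'M[R]_(m, n))
  (U : 'M[R]_(p, q)) : F *t (a *: U) = a *: (F *t U).
Proof. by apply/matrixP => i j; rewrite !mxE mulrCA. Qed.

Lemma tensmx11 (R : realType) (m n : nat) :
  (1%:M : 'M[R]_m) *t (1%:M : 'M[R]_n) = 1%:M.
Proof.
apply/matrixP => i j; case: (mxtens_indexP i) => i0 i1.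
case: (mxtens_indexP j) => j0 j1; rewrite tensmxE !mxE -natrM mulnb.
congr (_%:R); congr nat_of_bool; apply/idP/eqP.
  by move=> /andP[/eqP-> /eqP->].
by move=> /(congr1 (@mxtens_unindex _ _)); rewrite !mxtens_indexK => -[-> ->]; rewrite !eqxx.
Qed.

Lemma big_mxtens (R : realType) (m n : nat) (F : 'I_(m * n) -> R) :
  \sum_k F k = \sum_i \sum_j F (mxtens_index (i, j)).
Proof.
rewrite pair_big /= (reindex (@mxtens_index m n)) /=; first by apply: eq_bigr => -[].
by exists (@mxtens_unindex m n) => i _; rewrite ?mxtens_indexK ?mxtens_unindexK.
Qed.

Lemma l1norm_tens (R : realType) (m n p q : nat) (F : 'M[R]_(m, n))
  (U : 'M[R]_(p, q)) : l1norm (F *t U) = l1norm F * l1norm U.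
Proof.
rewrite /l1norm big_mxtens mulr_suml; apply: eq_bigr => i _.
rewrite mulr_sumr; apply: eq_bigr => k _.
rewrite big_mxtens mulr_suml; apply: eq_bigr => j _.
by rewrite mulr_sumr; apply: eq_bigr => l _; rewrite tensmxE normrM.
Qed.

(** The orthogonal projection of R^N onto the constant vectors. *)
Definition avg_mx (R : realType) (N : nat) : 'M[R]_N := N%:R^-1 *: const_mx 1.

Lemma avg_mx_mul (R : realType) (N : nat) : (0 < N)%N ->
  avg_mx R N *m avg_mx R N = avg_mx R N.
Proof.
move=> N0; apply/matrixP => i j; rewrite !mxE.
under eq_bigr do rewrite !mxE mulr1.
rewrite sumr_const card_ord mulr1 -[_ *+ N]mulr_natr -mulrA mulVf ?mulr1//.
by rewrite pnatr_eq0 -lt0n.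
Qed.

Lemma tr_avg_mx (R : realType) (N : nat) : (avg_mx R N)^T = avg_mx R N.
Proof. by apply/matrixP => i j; rewrite !mxE. Qed.

Lemma l1norm_avg (R : realType) (N : nat) : (0 < N)%N ->
  l1norm (avg_mx R N) = N%:R.
Proof.
move=> N0; rewrite /avg_mx l1normZ ger0_norm ?invr_ge0// /l1norm.
under eq_bigr do under eq_bigr do rewrite mxE normr1.
under eq_bigr do rewrite sumr_const card_ord.
rewrite sumr_const card_ord -[1 *+ N *+ N]mulr_natr mulrA mulVf ?mul1r//.
by rewrite pnatr_eq0 -lt0n.
Qed.

Lemma l1norm_1 (R : realType) (N : nat) : l1norm (1%:M : 'M[R]_N) = N%:R.
Proof.
rewrite /l1norm (eq_bigr (fun=> 1)); first by rewrite sumr_const card_ord.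
move=> i _; rewrite (bigD1 i)//= mxE eqxx normr1 big1 ?addr0// => j ji.
by rewrite mxE eq_sym (negbTE ji) normr0.
Qed.

(** An exchangeable block matrix acts as [U] on the fluctuations around the
    mean and as [V] on the mean itself; the two actions do not interact, so
    [(U, V) |-> exch_mx N U V] preserves all algebraic operations. *)
Definition exch_mx (R : realType) (N k l : nat) (U V : 'M[R]_(k, l)) :
    'M[R]_(N * k, N * l) :=
  (1%:M - avg_mx R N) *t U + avg_mx R N *t V.

Lemma exch_mxE (R : realType) (N k l : nat) (U V : 'M[R]_(k, l)) :
  exch_mx N U V = 1%:M *t U + avg_mx R N *t (V - U).
Proof. by rewrite /exch_mx tensmxBl tensmxBr addrAC addrA. Qed.

Lemma exch_mx_diag (R : realType) (N k l : nat) (U : 'M[R]_(k, l)) :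
  exch_mx N U U = 1%:M *t U.
Proof. by rewrite /exch_mx -tensmxDl subrK. Qed.

Lemma exch_mxM (R : realType) (N k l m : nat) (U V : 'M[R]_(k, l))
    (U' V' : 'M[R]_(l, m)) : (0 < N)%N ->
  exch_mx N U V *m exch_mx N U' V' = exch_mx N (U *m U') (V *m V').
Proof.
move=> N0; have EE := avg_mx_mul R N0.
rewrite /exch_mx mulmxDl !mulmxDr !tensmx_mul !(mulmxBl, mulmxBr).
by rewrite !mul1mx !mulmx1 EE !subrr !tens0mx subr0 addr0 add0r.
Qed.

Lemma exch_mxD (R : realType) (N k l : nat) (U V U' V' : 'M[R]_(k, l)) :
  exch_mx N U V + exch_mx N U' V' = exch_mx N (U + U') (V + V').
Proof. by rewrite /exch_mx !tensmxDr addrACA. Qed.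

Lemma exch_mxB (R : realType) (N k l : nat) (U V U' V' : 'M[R]_(k, l)) :
  exch_mx N U V - exch_mx N U' V' = exch_mx N (U - U') (V - V').
Proof. by rewrite /exch_mx !tensmxBr opprD addrACA. Qed.

Lemma exch_mxZ (R : realType) (N k l : nat) (a : R) (U V : 'M[R]_(k, l)) :
  a *: exch_mx N U V = exch_mx N (a *: U) (a *: V).
Proof. by rewrite /exch_mx scalerDr !tensmxZr. Qed.

Lemma tr_exch_mx (R : realType) (N k l : nat) (U V : 'M[R]_(k, l)) :
  (exch_mx N U V)^T = exch_mx N U^T V^T.
Proof.
rewrite /exch_mx.
have FT : (1%:M - avg_mx R N)^T = 1%:M - avg_mx R N.
  by apply/matrixP => i j; rewrite !mxE eq_sym.
by rewrite linearD/= !trmx_tens FT tr_avg_mx.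
Qed.

Lemma exch_mx1 (R : realType) (N k : nat) :
  exch_mx N (1%:M : 'M[R]_k) 1%:M = 1%:M.
Proof. by rewrite exch_mx_diag tensmx11. Qed.

Lemma exch_invmx (R : realType) (N k : nat) (U V : 'M[R]_k) : (0 < N)%N ->
  U \in unitmx -> V \in unitmx ->
  invmx (exch_mx N U V) = exch_mx N (invmx U) (invmx V).
Proof.
move=> N0 Uu Vu.
have H : exch_mx N (invmx U) (invmx V) *m exch_mx N U V = 1%:M.
  by rewrite exch_mxM// !mulVmx// exch_mx1.
have [_ Du] := mulmx1_unit H.
by rewrite -[RHS]mulmx1 -(mulmxV Du) mulmxA H mul1mx.
Qed.

Lemma l1norm_exch (R : realType) (N k l : nat) (U V : 'M[R]_(k, l)) :
  (0 < N)%N -> l1norm (exch_mx N U V) / N%:R <= l1norm U + l1norm (V - U).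
Proof.
move=> N0; rewrite exch_mxE ler_pdivrMr ?ltr0n//.
apply: le_trans (l1normD _ _) _.
by rewrite !l1norm_tens l1norm_avg// l1norm_1 -mulrDr mulrC.
Qed.

Lemma coercive_tens1 (R : realType) (N k : nat) (c : R) (U : 'M[R]_k) :
  coercive c U -> coercive c ((1%:M : 'M[R]_N) *t U).
Proof.
move=> Uc w; pose b i : 'cV[R]_k := \col_j w (mxtens_index (i, j)) 0.
have -> : (w^T *m w) 0 0 = \sum_i ((b i)^T *m b i) 0 0.
  rewrite sqnormE big_mxtens; apply: eq_bigr => i _; rewrite sqnormE.
  by apply: eq_bigr => j _; rewrite mxE.
have -> : (w^T *m (1%:M *t U) *m w) 0 0 = \sum_i ((b i)^T *m U *m b i) 0 0.
  rewrite mxE big_mxtens; apply: eq_bigr => i _; rewrite mxE.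
  apply: eq_bigr => j _; rewrite [b i j 0]mxE; congr (_ * _).
  rewrite !mxE big_mxtens (bigD1 i)//= [X in _ + X]big1 ?addr0.
    by apply: eq_bigr => h _; rewrite tensmxE !mxE eqxx mul1r.
  move=> i' i'i; rewrite big1// => h _.
  by rewrite tensmxE !mxE (negbTE i'i) mul0r mulr0.
by rewrite mulr_sumr; apply: ler_sum.
Qed.

(** The vector splits orthogonally into fluctuation [y] and mean [z], and each
    summand of the form sees only one of them. *)
Lemma coercive_exch (R : realType) (N k : nat) (c : R) (U V : 'M[R]_k) :
  (0 < N)%N -> coercive c U -> coercive c V -> coercive c (exch_mx N U V).
Proof.
move=> N0 /(coercive_tens1 (N := N)) Uc /(coercive_tens1 (N := N)) Vc w.
pose y := exch_mx N 1%:M 0 *m w; pose z := exch_mx N 0 1%:M *m w.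
have Q (U' V' : 'M[R]_k) : (w^T *m exch_mx N U' V' *m w) 0 0 =
    (y^T *m (1%:M *t U') *m y) 0 0 + (z^T *m (1%:M *t V') *m z) 0 0.
  have -> : exch_mx N U' V' = exch_mx N U' 0 + exch_mx N 0 V'.
    by rewrite exch_mxD addr0 add0r.
  have -> : exch_mx N U' 0 = exch_mx N 1%:M 0 *m exch_mx N U' U' *m exch_mx N 1%:M 0.
    by rewrite !exch_mxM// mul1mx mulmx1 !mulmx0.
  have -> : exch_mx N 0 V' = exch_mx N 0 1%:M *m exch_mx N V' V' *m exch_mx N 0 1%:M.
    by rewrite !exch_mxM// mul1mx mulmx1 !mulmx0.
  by rewrite mulmxDr mulmxDl [LHS]mxE /y /z !trmx_mul !tr_exch_mx !trmx1 !trmx0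
     !exch_mx_diag !mulmxA.
have Q1 : (w^T *m w) 0 0 = (y^T *m y) 0 0 + (z^T *m z) 0 0.
  by have := Q 1%:M 1%:M; rewrite exch_mx1 tensmx11 !mulmx1.
by rewrite Q Q1 mulrDr lerD.
Qed.

(** Testing on [v (x) x] with [v] summing to zero, respectively constant,
    isolates the two actions; the first kind of [v] exists only for [1 < N]. *)
Lemma exch_coercive (R : realType) (N k : nat) (c : R) (U V : 'M[R]_k) :
  (1 < N)%N -> coercive c (exch_mx N U V) -> coercive c U /\ coercive c V.
Proof.
move=> N1 Dc; have N0 : (0 < N)%N by apply: ltnW.
have test (v : 'cV[R]_N) (x : 'cV[R]_k) a b :
    v^T *m (1%:M - avg_mx R N) *m v = a%:M -> v^T *m avg_mx R N *m v = b%:M ->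
    c * ((a + b) * (x^T *m x) 0 0) <=
      a * (x^T *m U *m x) 0 0 + b * (x^T *m V *m x) 0 0.
  move=> va vb.
  have E (u : R) (F : 'M[R]_1) : ((u%:M : 'M[R]_1) *t F) 0 0 = u * F 0 0.
    by rewrite mxE !ord1 mxE eqxx mulr1n.
  have Qe (U' V' : 'M[R]_k) :
      ((v *t x)^T *m exch_mx N U' V' *m (v *t x)) 0 0 =
      a * (x^T *m U' *m x) 0 0 + b * (x^T *m V' *m x) 0 0.
    rewrite trmx_tens /exch_mx mulmxDr mulmxDl !tensmx_mul va vb mxE.
    by rewrite !E.
  have Qe1 : ((v *t x)^T *m (v *t x)) 0 0 = (a + b) * (x^T *m x) 0 0.
    by have := Qe 1%:M 1%:M; rewrite exch_mx1 !mulmx1 -mulrDl.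
  by have := Dc (v *t x); rewrite Qe Qe1.
have sum_avg (v : 'cV[R]_N) :
    v^T *m avg_mx R N *m v = (N%:R^-1 * (\sum_i v i 0) ^+ 2)%:M.
  apply/matrixP => i j; rewrite !ord1 !mxE eqxx mulr1n.
  under eq_bigr do rewrite mxE.
  rewrite expr2 mulrA mulr_sumr; apply: eq_bigr => h _; congr (_ * _).
  by rewrite mulr_sumr; apply: eq_bigr => h' _; rewrite !mxE mulr1 mulrC.
have sq (v : 'cV[R]_N) : v^T *m v = (\sum_i v i 0 ^+ 2)%:M.
  by apply/matrixP => i j; rewrite !ord1 sqnormE mxE eqxx mulr1n.
have scalB (a b : R) : (a%:M : 'M[R]_1) - b%:M = (a - b)%:M.
  by apply/matrixP => i j; rewrite !mxE mulrnBl.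
have fluct (v : 'cV[R]_N) : v^T *m (1%:M - avg_mx R N) *m v =
    v^T *m v - v^T *m avg_mx R N *m v by rewrite mulmxBr mulmxBl mulmx1.
split=> x.
  pose i0 : 'I_N := Ordinal N0; pose i1 : 'I_N := Ordinal N1.
  pose v : 'cV[R]_N := delta_mx i0 0 - delta_mx i1 0.
  have v0 : \sum_i v i 0 = 0.
    rewrite (bigD1 i0)//= (bigD1 i1)//= big1 ?addr0; last first.
      by move=> i /andP[/negbTE h0 /negbTE h1]; rewrite !mxE h0 h1 subrr.
    by rewrite !mxE !eqxx /= subr0 sub0r subrr.
  have v2 : \sum_i v i 0 ^+ 2 = 2.
    rewrite (bigD1 i0)//= (bigD1 i1)//= big1 ?addr0; last first.
      by move=> i /andP[/negbTE h0 /negbTE h1]; rewrite !mxE h0 h1 subrr expr0n.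
    by rewrite !mxE !eqxx /= subr0 sub0r sqrrN expr1n.
  have vb : v^T *m avg_mx R N *m v = 0%:M.
    by rewrite sum_avg v0 expr0n mulr0.
  have va : v^T *m (1%:M - avg_mx R N) *m v = 2%:M.
    by rewrite fluct vb sq v2 scalB subr0.
  have := test v x _ _ va vb; rewrite addr0 mul0r addr0 mulrCA.
  by rewrite ler_pM2l.
pose v : 'cV[R]_N := const_mx 1.
have vb : v^T *m avg_mx R N *m v = N%:R%:M.
  rewrite sum_avg; congr (_%:M); under eq_bigr do rewrite mxE.
  by rewrite sumr_const card_ord expr2 mulrA mulVf ?mul1r// pnatr_eq0 -lt0n.
have va : v^T *m (1%:M - avg_mx R N) *m v = 0%:M.
  rewrite fluct vb sq scalB; congr (_%:M).
  under eq_bigr do rewrite mxE expr1n.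
  by rewrite sumr_const card_ord subrr.
have := test v x _ _ va vb; rewrite add0r mul0r add0r mulrCA.
by rewrite ler_pM2l ?ltr0n.
Qed.

(** * The large-scale Riccati equation on exchangeable matrices *)

(** [(1 - eps) *: X + eps *: S] is the diagonal block of [exch_mx N X S] for
    [eps = 1/N]: it is what the individual noises see of the matrix. *)
Definition fluct_weight (R : realType) (n n1 : nat) (p : social_problem R n n1)
    (eps : R) (X S : 'M[R]_n) : 'M[R]_n1 :=
  cR p + (cB1 p)^T *m ((1 - eps) *: X + eps *: S) *m cB1 p.

(** The common noise acts on the mean only. *)
Definition mean_weight (R : realType) (n n1 : nat) (p : social_problem R n n1)
    (eps : R) (X S : 'M[R]_n) : 'M[R]_n1 :=
  fluct_weight p eps X S + (cB0 p)^T *m S *m cB0 p.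

(** For [eps = 0] this no longer depends on [S]: the limit system is
    triangular. *)
Definition fluct_rhs (R : realType) (n n1 : nat) (p : social_problem R n n1)
    (eps : R) (X S : 'M[R]_n) : 'M[R]_n :=
  ric (cB p) (cA p) (cQ p) X (fluct_weight p eps X S).

Definition mean_rhs (R : realType) (n n1 : nat) (p : social_problem R n n1)
    (eps : R) (X S : 'M[R]_n) : 'M[R]_n :=
  ric (cB p) (cA p + cG p) (cQ p + QGamma p) S (mean_weight p eps X S).

Lemma const1_tens (R : realType) (N k l : nat) (U : 'M[R]_(k, l)) :
  (const_mx 1 : 'M[R]_N) *t (N%:R^-1 *: U) = avg_mx R N *t U.
Proof. by rewrite tensmxZr /avg_mx tensmxZl. Qed.

Lemma bigA_exch (R : realType) (n n1 : nat) (p : social_problem R n n1) N :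
  bigA p N = exch_mx N (cA p) (cA p + cG p).
Proof. by rewrite /bigA const1_tens exch_mxE [cA p + _]addrC addrK. Qed.

Lemma bigB_exch (R : realType) (n n1 : nat) (p : social_problem R n n1) N :
  bigB p N = exch_mx N (cB p) (cB p).
Proof. by rewrite exch_mx_diag. Qed.

Lemma bigQ_exch (R : realType) (n n1 : nat) (p : social_problem R n n1) N :
  bigQ p N = exch_mx N (cQ p) (cQ p + QGamma p).
Proof. by rewrite /bigQ const1_tens exch_mxE [cQ p + _]addrC addrK. Qed.

Lemma bigQf_exch (R : realType) (n n1 : nat) (p : social_problem R n n1) N :
  bigQf p N = exch_mx N (cQf p) (cQf p + QfGamma p).
Proof. by rewrite /bigQf const1_tens exch_mxE [cQf p + _]addrC addrK. Qed.

Lemma bigR_exch (R : realType) (n n1 : nat) (p : social_problem R n n1) N :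
  bigR p N = exch_mx N (cR p) (cR p).
Proof. by rewrite exch_mx_diag. Qed.

Lemma bigBk_block_e (R : realType) (n n1 : nat) (p : social_problem R n n1) N
    (i : 'I_N) :
  bigBk p i *m block_e R n1 i = (delta_mx i i : 'M[R]_N) *t cB1 p.
Proof.
rewrite /bigBk /block_e trmx_tens tensmx_mul trmx1 mulmx1.
by rewrite trmx_delta mul_delta_mx.
Qed.

Lemma bigB0_Ihat (R : realType) (n n1 : nat) (p : social_problem R n n1) N :
  bigB0 p N *m Ihat R n1 N = exch_mx N 0 (cB0 p).
Proof.
rewrite /bigB0 /Ihat tensmx_mul mulmx1 /exch_mx tensmx0 add0r -const1_tens.
congr (_ *t _); apply/matrixP => i j.
by rewrite !mxE big_ord1 !mxE mulr1.
Qed.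

Lemma big_weightE (R : realType) (n n1 : nat) (p : social_problem R n n1) N
    (Z : 'M[R]_(N * n)) :
  big_weight p Z = bigR p N
    + \sum_(i < N) ((delta_mx i i : 'M[R]_N) *t cB1 p)^T *m Z
        *m ((delta_mx i i : 'M[R]_N) *t cB1 p)
    + (exch_mx N 0 (cB0 p))^T *m Z *m exch_mx N 0 (cB0 p).
Proof.
rewrite /big_weight /M2 -scalerDr scalerA mulfV ?pnatr_eq0// scale1r addrA.
congr (_ + _ + _).
  by apply: eq_bigr => i _; rewrite -bigBk_block_e trmx_mul !mulmxA.
by rewrite -bigB0_Ihat trmx_mul !mulmxA.
Qed.

(** Compressing to the i-th agent replaces [F (x) U] by the scalar [F i i] times
    [U]; the diagonal entries are [1 - 1/N] for [I - E] and [1/N] for [E]. *)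
Lemma big_weight_exch (R : realType) (n n1 : nat) (p : social_problem R n n1) N
    (X S : 'M[R]_n) : (0 < N)%N ->
  big_weight p (exch_mx N X S) =
    exch_mx N (fluct_weight p N%:R^-1 X S) (mean_weight p N%:R^-1 X S).
Proof.
move=> N0; rewrite big_weightE bigR_exch.
have -> : \sum_(i < N) ((delta_mx i i : 'M[R]_N) *t cB1 p)^T *m exch_mx N X S
    *m ((delta_mx i i : 'M[R]_N) *t cB1 p) =
    1%:M *t ((cB1 p)^T *m ((1 - N%:R^-1) *: X + N%:R^-1 *: S) *m cB1 p).
  have D (F : 'M[R]_N) i : delta_mx i i *m F *m delta_mx i i = F i i *: delta_mx i i.
    apply/matrixP => a b; rewrite !mxE (bigD1 i)//= big1 ?addr0.
      rewrite !mxE (bigD1 i)//= big1 ?addr0 => [|h hi].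
        by rewrite !mxE !eqxx andbT; case: (a == i); case: (b == i);
          rewrite /= ?(mulr0, mul0r, mulr1, mul1r).
      by rewrite !mxE (negbTE hi) andbF mul0r.
    by move=> h hi; rewrite [X in _ * X]mxE (negbTE hi) mulr0.
  transitivity (\sum_(i < N) (delta_mx i i : 'M[R]_N) *t
      ((cB1 p)^T *m ((1 - N%:R^-1) *: X + N%:R^-1 *: S) *m cB1 p)).
    apply: eq_bigr => i _; rewrite trmx_tens trmx_delta.
    rewrite /exch_mx mulmxDr mulmxDl !tensmx_mul !D !mxE eqxx mulr1.
    rewrite !tensmxZl -!tensmxZr -tensmxDr; congr (_ *t _).
    by rewrite mulmxDr mulmxDl -!(scalemxAl, scalemxAr).
  apply/matrixP => a b; case: (mxtens_indexP a) => a0 a1.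
  case: (mxtens_indexP b) => b0 b1; rewrite summxE tensmxE.
  under eq_bigr do rewrite tensmxE.
  rewrite -mulr_suml; congr (_ * _); rewrite mxE.
  rewrite (bigD1 a0)//= big1 ?addr0 => [|h ha]; first by rewrite mxE eqxx eq_sym.
  by rewrite mxE eq_sym (negbTE ha).
rewrite -exch_mx_diag tr_exch_mx !exch_mxM// !exch_mxD.
by rewrite trmx0 !mul0mx addr0.
Qed.

Lemma big_riccati_rhsE (R : realType) (n n1 : nat) (p : social_problem R n n1) N
    (Z : 'M[R]_(N * n)) :
  big_riccati_rhs p Z = ric (bigB p N) (bigA p N) (bigQ p N) Z (big_weight p Z).
Proof. by []. Qed.

Lemma big_riccati_rhs_exch (R : realType) (n n1 : nat)
    (p : social_problem R n n1) N (X S : 'M[R]_n) : (0 < N)%N ->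
  fluct_weight p N%:R^-1 X S \in unitmx -> mean_weight p N%:R^-1 X S \in unitmx ->
  big_riccati_rhs p (exch_mx N X S) =
    exch_mx N (fluct_rhs p N%:R^-1 X S) (mean_rhs p N%:R^-1 X S).
Proof.
move=> N0 Wu Wu'; rewrite /big_riccati_rhs big_weight_exch// exch_invmx//.
rewrite bigA_exch bigB_exch bigQ_exch !tr_exch_mx !exch_mxM// !exch_mxB.
by [].
Qed.

(** * Exchangeability of the large-scale solution *)

Definition relabel (R : realType) (N k : nat) (s : {perm 'I_N}) : 'M[R]_(N * k) :=
  perm_mx s *t 1%:M.

Lemma relabelK (R : realType) (N k : nat) (s : {perm 'I_N}) :
  (relabel R k s)^T *m relabel R k s = 1%:M.
Proof.
rewrite /relabel trmx_tens tensmx_mul trmx1 mulmx1 tr_perm_mx -perm_mxM.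
by rewrite mulVg perm_mx1 tensmx11.
Qed.

Lemma relabelKV (R : realType) (N k : nat) (s : {perm 'I_N}) :
  relabel R k s *m (relabel R k s)^T = 1%:M.
Proof. by apply: mulmx1C; exact: relabelK. Qed.

Lemma relabel_exch (R : realType) (N k l : nat) (s : {perm 'I_N})
    (U V : 'M[R]_(k, l)) :
  relabel R k s *m exch_mx N U V = exch_mx N U V *m relabel R l s.
Proof.
have E : perm_mx s *m avg_mx R N = avg_mx R N *m perm_mx s.
  rewrite -row_permE -[s]invgK -col_permE.
  by apply/matrixP => i j; rewrite !mxE.
rewrite /relabel /exch_mx mulmxDr mulmxDl !tensmx_mul !mul1mx !mulmx1.
by rewrite mulmxBr mulmxBl E mulmx1 mul1mx.
Qed.

Lemma relabel_exch_tr (R : realType) (N k l : nat) (s : {perm 'I_N})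
    (U V : 'M[R]_(k, l)) :
  (relabel R k s)^T *m exch_mx N U V = exch_mx N U V *m (relabel R l s)^T.
Proof.
rewrite -[LHS]mulmx1 -(relabelKV R l s) !mulmxA; congr (_ *m _).
by rewrite -(mulmxA _ (exch_mx _ _ _)) -relabel_exch mulmxA relabelK mul1mx.
Qed.

(** Conjugation by [relabel]: the agents are renamed by [s]. *)
Definition relabelled (R : realType) (N k : nat) (s : {perm 'I_N})
    (Z : 'M[R]_(N * k)) : 'M[R]_(N * k) :=
  relabel R k s *m Z *m (relabel R k s)^T.

Lemma relabelled_exch (R : realType) (N k : nat) (s : {perm 'I_N})
    (U V : 'M[R]_k) : relabelled s (exch_mx N U V) = exch_mx N U V.
Proof. by rewrite /relabelled relabel_exch -mulmxA relabelKV mulmx1. Qed.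

Lemma relabelledD (R : realType) (N k : nat) (s : {perm 'I_N})
    (Y Z : 'M[R]_(N * k)) :
  relabelled s (Y + Z) = relabelled s Y + relabelled s Z.
Proof. by rewrite /relabelled mulmxDr mulmxDl. Qed.

Lemma relabelledB (R : realType) (N k : nat) (s : {perm 'I_N})
    (Y Z : 'M[R]_(N * k)) :
  relabelled s (Y - Z) = relabelled s Y - relabelled s Z.
Proof. by rewrite /relabelled mulmxBr mulmxBl. Qed.

(** Relabelling only permutes the individual noises, and it commutes with the
    exchangeable coefficients. *)
Lemma big_weight_relabelled (R : realType) (n n1 : nat)
    (p : social_problem R n n1) N (s : {perm 'I_N}) (Z : 'M[R]_(N * n)) :
  big_weight p (relabelled s Z) = relabelled s (big_weight p Z).
Proof.
rewrite !big_weightE !relabelledD; congr (_ + _ + _).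
- by rewrite bigR_exch relabelled_exch.
- rewrite [RHS]/relabelled mulmx_sumr mulmx_suml.
  have E i : (relabel R n s)^T *m ((delta_mx i i : 'M[R]_N) *t cB1 p) =
      ((delta_mx (s i) (s i) : 'M[R]_N) *t cB1 p) *m (relabel R n1 s)^T.
    rewrite /relabel !trmx_tens !tensmx_mul !trmx1 mul1mx mulmx1 tr_perm_mx.
    congr (_ *t _); rewrite -row_permE -{2}[s]invgK -col_permE invgK.
    apply/matrixP => a b; rewrite !mxE.
    by rewrite (can2_eq (permKV s) (permK s)) (can_eq (permK s)).
  rewrite [RHS](reindex_inj (@perm_inj _ s)) /=.
  apply: eq_bigr => i _; rewrite /relabelled.
  have Ei := E i; have Et := congr1 trmx Ei.
  rewrite !trmx_mul !trmxK in Et.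
  by rewrite !mulmxA Et -!mulmxA Ei !mulmxA.
- rewrite /relabelled tr_exch_mx !mulmxA -relabel_exch.
  by rewrite -[LHS]mulmxA relabel_exch_tr !mulmxA.
Qed.

Lemma relabelled_invmx (R : realType) (N k : nat) (s : {perm 'I_N})
    (W : 'M[R]_(N * k)) : W \in unitmx ->
  invmx (relabelled s W) = relabelled s (invmx W).
Proof.
move=> Wu; have H : relabelled s (invmx W) *m relabelled s W = 1%:M.
  rewrite /relabelled -!mulmxA (mulmxA _ (relabel _ _ _)) relabelK mul1mx.
  by rewrite (mulmxA (invmx W)) mulVmx// mul1mx relabelKV.
have [_ Du] := mulmx1_unit H.
by rewrite -[RHS]mulmx1 -(mulmxV Du) mulmxA H mul1mx.
Qed.

Lemma big_riccati_rhs_relabelled (R : realType) (n n1 : nat)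
    (p : social_problem R n n1) N (s : {perm 'I_N}) (Z : 'M[R]_(N * n)) :
  big_weight p Z \in unitmx ->
  big_riccati_rhs p (relabelled s Z) = relabelled s (big_riccati_rhs p Z).
Proof.
move=> Wu; rewrite /big_riccati_rhs big_weight_relabelled relabelled_invmx//.
rewrite bigA_exch bigB_exch !relabelledB.
rewrite bigQ_exch relabelled_exch !tr_exch_mx.
have KR k l (Y : 'M[R]_(N * k, l)) : (relabel R k s)^T *m (relabel R k s *m Y) = Y.
  by rewrite mulmxA relabelK mul1mx.
have X1 k l m (U V : 'M[R]_(k, l)) (Y : 'M[R]_(N * l, m)) :
    (relabel R k s)^T *m (exch_mx N U V *m Y) = exch_mx N U V *m ((relabel R l s)^T *m Y).
  by rewrite mulmxA relabel_exch_tr mulmxA.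
have X2 k l m (U V : 'M[R]_(k, l)) (Y : 'M[R]_(N * l, m)) :
    relabel R k s *m (exch_mx N U V *m Y) = exch_mx N U V *m (relabel R l s *m Y).
  by rewrite mulmxA relabel_exch mulmxA.
congr (_ - _ - _ - _); rewrite /relabelled -!mulmxA.
- by rewrite !X1 !KR.
- by rewrite relabel_exch_tr.
- by rewrite X2.
Qed.

Lemma coercive_relabelled (R : realType) (N k : nat) (s : {perm 'I_N}) (c : R)
    (M : 'M[R]_(N * k)) : coercive c M -> coercive c (relabelled s M).
Proof.
move=> Mc x; have := Mc ((relabel R k s)^T *m x).
by rewrite trmx_mul trmxK -!mulmxA (mulmxA (relabel R k s) _ x) relabelKV mul1mx !mulmxA.
Qed.

Lemma big_weight_lip (R : realType) (n n1 : nat) (p : social_problem R n n1) N :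
  exists2 K : R, 0 <= K & forall Z Z' : 'M[R]_(N * n),
    l1norm (big_weight p Z - big_weight p Z') <= K * l1norm (Z - Z').
Proof.
pose g i := l1norm ((delta_mx i i : 'M[R]_N) *t cB1 p).
pose g0 := l1norm (exch_mx N 0 (cB0 p)).
exists (\sum_(i < N) g i * g i + g0 * g0).
  by rewrite addr_ge0 ?sumr_ge0// => *; rewrite mulr_ge0// l1norm_ge0.
move=> Z Z'; rewrite !big_weightE.
have bd k (F : 'M[R]_(N * n, k)) :
    l1norm (F^T *m (Z - Z') *m F) <= l1norm F * l1norm F * l1norm (Z - Z').
  by rewrite mulrAC l1normM_le// l1normM_le// l1norm_tr.
set s1 := \sum_(i < N) _; set s2 := \sum_(i < N) _.
have -> : bigR p N + s1 + (exch_mx N 0 (cB0 p))^T *m Z *m exch_mx N 0 (cB0 p)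
  - (bigR p N + s2 + (exch_mx N 0 (cB0 p))^T *m Z' *m exch_mx N 0 (cB0 p)) =
  (s1 - s2) + (exch_mx N 0 (cB0 p))^T *m (Z - Z') *m exch_mx N 0 (cB0 p).
  rewrite mulmxBr mulmxBl; move: (_ *m Z *m _) (_ *m Z' *m _) => a b.
  by apply/matrixP => i j; rewrite !mxE; ring.
apply: le_trans (l1normD _ _) _; rewrite mulrDl lerD ?bd// /s1 /s2 -sumrB mulr_suml.
have sumle (I : Type) (r : seq I) (F : I -> 'M[R]_(N * n1)) (b : I -> R) :
    (forall i, l1norm (F i) <= b i) -> l1norm (\sum_(i <- r) F i) <= \sum_(i <- r) b i.
  move=> Fb; elim: r => [|i r IH]; first by rewrite !big_nil l1norm0.
  by rewrite !big_cons; apply: le_trans (l1normD _ _) _; rewrite lerD.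
by apply: sumle => i; rewrite -mulmxBl -mulmxBr bd.
Qed.

(** For fixed [N] the field is Lipschitz on bounded sets of matrices with
    uniformly coercive weight, so Gronwall's inequality gives uniqueness. *)
Lemma big_riccati_unique (R : realType) (n n1 : nat) (p : social_problem R n n1)
    N (c C : R) (P P' : R -> 'M[R]_(N * n)) :
  0 < c -> 0 <= C -> P (horizon p) = P' (horizon p) ->
  (forall t, 0 <= t <= horizon p -> [/\
     has_derivative_in (horizon p) P t (big_riccati_rhs p (P t)),
     l1norm (P t) <= C & coercive c (big_weight p (P t))]) ->
  (forall t, 0 <= t <= horizon p -> [/\
     has_derivative_in (horizon p) P' t (big_riccati_rhs p (P' t)),
     l1norm (P' t) <= C & coercive c (big_weight p (P' t))]) ->
  forall t, 0 <= t <= horizon p -> P t = P' t.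
Proof.
move=> c0 C0 PT H H' t tT; apply/eqP; rewrite -subr_eq0; apply/eqP/l1norm_le0.
have [L L0 LP] := ric_lip (bigB p N) (bigA p N) c0 C0.
have [K K0 KP] := big_weight_lip p N.
rewrite -(mulr0 (gronwall_const (N * n) (N * n) (horizon p) (L * (1 + K)))).
apply: (@gronwall R _ _ (horizon p) (L * (1 + K)) (C + C) 0
  (fun s => P s - P' s)
  (fun s => big_riccati_rhs p (P s) - big_riccati_rhs p (P' s))) => //.
- by rewrite mulr_ge0// addr_ge0.
- by rewrite PT subrr.
- move=> s sT; have [? _ _] := H s sT; have [? _ _] := H' s sT.
  exact: has_derivative_inB.
- move=> s sT; have [_ ? _] := H s sT; have [_ ? _] := H' s sT.
  by apply: le_trans (l1normB _ _) _; rewrite lerD.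
- move=> s sT; have [_ ? ?] := H s sT; have [_ ? ?] := H' s sT.
  rewrite addr0 !big_riccati_rhsE; apply: le_trans (LP _ _ _ _ _ _ _ _ _) _ => //.
  by rewrite -mulrA ler_wpM2l// mulrDl mul1r lerD.
Qed.

Definition blk (R : realType) (N k l : nat) (Z : 'M[R]_(N * k, N * l))
    (i j : 'I_N) : 'M[R]_(k, l) :=
  \matrix_(a, b) Z (mxtens_index (i, a)) (mxtens_index (j, b)).

Lemma l1norm_blk (R : realType) (N k l : nat) (Z : 'M[R]_(N * k, N * l)) :
  l1norm Z = \sum_i \sum_j l1norm (blk Z i j).
Proof.
rewrite {1}/l1norm big_mxtens; apply: eq_bigr => i _.
rewrite [RHS]exchange_big; apply: eq_bigr => a _ /=; rewrite big_mxtens.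
by apply: eq_bigr => j _; apply: eq_bigr => b _; rewrite mxE.
Qed.

Lemma l1norm_blk_le (R : realType) (N k l : nat) (Z : 'M[R]_(N * k, N * l)) i j :
  l1norm (blk Z i j) <= l1norm Z.
Proof.
rewrite [leRHS]l1norm_blk (bigD1 i)//= (bigD1 j)//= -addrA lerDl.
rewrite addr_ge0// sumr_ge0// => *; first exact: l1norm_ge0.
by rewrite sumr_ge0// => *; exact: l1norm_ge0.
Qed.

Lemma blk_exch (R : realType) (N k l : nat) (U V : 'M[R]_(k, l)) (i j : 'I_N) :
  blk (exch_mx N U V) i j = (i == j)%:R *: U + N%:R^-1 *: (V - U).
Proof.
by apply/matrixP => a b; rewrite exch_mxE mxE [LHS]mxE !tensmxE !mxE mulr1.
Qed.

(** Inverse of [exch_mx] on exchangeable matrices: a diagonal and an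
    off-diagonal block determine the two actions. *)
Definition fluct_part (R : realType) (N k : nat) (i0 i1 : 'I_N)
    (Z : 'M[R]_(N * k)) : 'M[R]_k := blk Z i0 i0 - blk Z i0 i1.

Definition mean_part (R : realType) (N k : nat) (i0 i1 : 'I_N)
    (Z : 'M[R]_(N * k)) : 'M[R]_k := blk Z i0 i0 + (N%:R - 1) *: blk Z i0 i1.

Lemma fluct_part_exch (R : realType) (N k : nat) (i0 i1 : 'I_N)
    (U V : 'M[R]_k) : i0 != i1 -> fluct_part i0 i1 (exch_mx N U V) = U.
Proof.
move=> /negbTE i01; rewrite /fluct_part !blk_exch eqxx i01 scale1r scale0r add0r.
by rewrite addrK.
Qed.

Lemma mean_part_exch (R : realType) (N k : nat) (i0 i1 : 'I_N)
    (U V : 'M[R]_k) : i0 != i1 -> mean_part i0 i1 (exch_mx N U V) = V.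
Proof.
move=> /negbTE i01; rewrite /mean_part !blk_exch eqxx i01 scale1r scale0r add0r.
have N0 : N%:R != 0 :> R by rewrite pnatr_eq0 -lt0n (leq_ltn_trans _ (ltn_ord i0)).
by apply/matrixP => a b; rewrite !mxE; field.
Qed.

Lemma blk_relabelled (R : realType) (N k : nat) (s : {perm 'I_N})
    (Z : 'M[R]_(N * k)) i j : blk (relabelled s Z) i j = blk Z (s i) (s j).
Proof.
have H l (Y : 'M[R]_(N * k, l)) x a c :
    (relabel R k s *m Y) (mxtens_index (x, a)) c = Y (mxtens_index (s x, a)) c.
  rewrite mxE big_mxtens (bigD1 (s x))//= [X in _ + X]big1 ?addr0; last first.
    move=> y ys; rewrite big1// => b _.
    by rewrite tensmxE !mxE eq_sym (negbTE ys) !mul0r.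
  rewrite (bigD1 a)//= [X in _ + X]big1 ?addr0; last first.
    by move=> b ba; rewrite tensmxE !mxE eq_sym (negbTE ba) mulr0 mul0r.
  by rewrite tensmxE !mxE !eqxx !mul1r.
apply/matrixP => a b; rewrite [LHS]mxE [RHS]mxE.
have -> : relabelled s Z = (relabel R k s *m (relabel R k s *m Z)^T)^T.
  by rewrite /relabelled trmx_mul trmxK.
by rewrite mxE H mxE H.
Qed.

(** The symmetric group is transitive on indices and on pairs of distinct
    indices, so all diagonal blocks agree and all off-diagonal blocks agree. *)
Lemma exchangeable_exch (R : realType) (N k : nat) (i0 i1 : 'I_N)
    (Z : 'M[R]_(N * k)) : i0 != i1 ->
  (forall s : {perm 'I_N}, relabelled s Z = Z) ->
  Z = exch_mx N (fluct_part i0 i1 Z) (mean_part i0 i1 Z).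
Proof.
move=> i01 Zs.
have N0 : N%:R != 0 :> R by rewrite pnatr_eq0 -lt0n (leq_ltn_trans _ (ltn_ord i0)).
have Zb (s : {perm 'I_N}) i j : blk Z i j = blk Z (s i) (s j) by rewrite -[in LHS](Zs s) blk_relabelled.
apply/matrixP => x y; case: (mxtens_indexP x) => i a; case: (mxtens_indexP y) => j b.
transitivity (blk Z i j a b); first by rewrite mxE.
transitivity (blk (exch_mx N (fluct_part i0 i1 Z) (mean_part i0 i1 Z)) i j a b);
  last by rewrite mxE.
congr ((_ : 'M[R]_k) a b); rewrite blk_exch.
have -> : mean_part i0 i1 Z - fluct_part i0 i1 Z = N%:R *: blk Z i0 i1.
  by rewrite /mean_part /fluct_part; apply/matrixP => c d; rewrite !mxE; ring.
rewrite scalerA mulVf// scale1r /fluct_part.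
have [->|ij] := eqVneq i j.
  by rewrite scale1r subrK (Zb (tperm j i0)) tpermL.
rewrite scale0r add0r (Zb (tperm i i0 * tperm (tperm i i0 j) i1)%g) !permM tpermL.
have h : tperm i i0 j != i0.
  by rewrite -[X in _ != X](tpermL i i0) (inj_eq perm_inj) eq_sym.
rewrite tpermL; move: (tperm i i0 j) h => j' h; rewrite tpermD//.
by rewrite eq_sym.
Qed.

(** With [d = (V - U) / N], each of the [N] block rows has one diagonal block
    [U + d] and [N - 1] off-diagonal blocks [d]; both [U] and [V = (U + d) + (N - 1) d] are bounded
    by the norm of a single block row. *)
Lemma exch_l1norm (R : realType) (N k : nat) (i0 i1 : 'I_N) (U V : 'M[R]_k) :
  i0 != i1 -> l1norm U <= l1norm (exch_mx N U V) / N%:R /\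
              l1norm V <= l1norm (exch_mx N U V) / N%:R.
Proof.
move=> i01; have N0 : (0 < N)%N by rewrite (leq_ltn_trans _ (ltn_ord i0)).
have N1 : (1 < N)%N.
  by move: i01; case: N i0 i1 N0 {U V} => [|[|N]]// i0 i1; rewrite !ord1.
have N1' : 1 <= N%:R - 1 :> R by rewrite lerBrDr -[1 + 1]/(2%:R) ler_nat.
pose d := N%:R^-1 *: (V - U).
have -> : l1norm (exch_mx N U V) / N%:R = l1norm (U + d) + (N%:R - 1) * l1norm d.
  rewrite l1norm_blk (eq_bigr (fun=> l1norm (U + d) + (N%:R - 1) * l1norm d)).
    rewrite sumr_const card_ord -[_ *+ N]mulr_natr mulfK// pnatr_eq0 -lt0n//.
  move=> i _; rewrite (bigD1 i)//= blk_exch eqxx scale1r; congr (_ + _).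
  rewrite (eq_bigr (fun=> l1norm d)) => [|j ji].
    rewrite sumr_const cardC1 card_ord -[l1norm d *+ _]mulr_natl; congr (_ * _).
    by rewrite -subn1 natrB.
  by rewrite blk_exch eq_sym (negbTE ji) scale0r add0r.
have d0 : 0 <= l1norm d := l1norm_ge0 d.
split.
  rewrite -{1}[U](addrK d); apply: le_trans (l1normB _ _) _.
  by rewrite lerD2l ler_peMl.
have -> : V = (U + d) + (N%:R - 1) *: d.
  rewrite /d; apply/matrixP => a b; rewrite !mxE; field.
  by rewrite pnatr_eq0 -lt0n.
apply: le_trans (l1normD _ _) _; rewrite lerD2l l1normZ ger0_norm//.
exact: le_trans N1'.
Qed.

(** * The coupled small system *)

(** The pair (X, S) is stored as one block row, so that the analytic lemmas
    apply to it directly. *)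
Definition pair_rhs (R : realType) (n n1 : nat) (p : social_problem R n n1)
    (eps : R) (Y : 'M[R]_(n, n + n)) : 'M[R]_(n, n + n) :=
  row_mx (fluct_rhs p eps (lsubmx Y) (rsubmx Y))
         (mean_rhs p eps (lsubmx Y) (rsubmx Y)).

Definition admissible (R : realType) (n n1 : nat) (p : social_problem R n n1)
    (c C eps : R) (Y : 'M[R]_(n, n + n)) : Prop :=
  [/\ 0 <= eps <= 1, l1norm Y <= C,
      coercive c (fluct_weight p eps (lsubmx Y) (rsubmx Y)) &
      coercive c (mean_weight p eps (lsubmx Y) (rsubmx Y))].

(** The difference of the arguments of [fluct_weight] is
    [(1 - eps) (X - X') + eps (S - S') + (eps - eps') (S' - X')]. *)
Lemma weight_lip (R : realType) (n n1 : nat) (p : social_problem R n n1) :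
  exists2 K : R, 0 <= K & forall (eps eps' C : R) (Y Y' : 'M[R]_(n, n + n)),
    0 <= eps <= 1 -> l1norm Y' <= C ->
    l1norm (fluct_weight p eps (lsubmx Y) (rsubmx Y)
            - fluct_weight p eps' (lsubmx Y') (rsubmx Y')) <=
      K * (l1norm (Y - Y') + `|eps - eps'| * C) /\
    l1norm (mean_weight p eps (lsubmx Y) (rsubmx Y)
            - mean_weight p eps' (lsubmx Y') (rsubmx Y')) <=
      K * (l1norm (Y - Y') + `|eps - eps'| * C).
Proof.
pose b1 := l1norm (cB1 p); pose b0 := l1norm (cB0 p).
have b1p : 0 <= b1 * b1 by rewrite mulr_ge0// l1norm_ge0.
have b0p : 0 <= b0 * b0 by rewrite mulr_ge0// l1norm_ge0.
exists (b1 * b1 + b0 * b0); first exact: addr_ge0.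
move=> eps eps' C Y Y' /andP[e0 e1] YC.
set X := lsubmx Y; set S := rsubmx Y; set X' := lsubmx Y'; set S' := rsubmx Y'.
have bd k l (F : 'M[R]_(k, l)) (Z : 'M[R]_k) :
    l1norm (F^T *m Z *m F) <= l1norm F * l1norm F * l1norm Z.
  by rewrite mulrAC l1normM_le// l1normM_le// l1norm_tr.
have YY : l1norm (Y - Y') = l1norm (X - X') + l1norm (S - S').
  by rewrite l1norm_hsub !linearB.
set d := l1norm (Y - Y') + `|eps - eps'| * C.
have C0 : 0 <= C by apply: le_trans YC; exact: l1norm_ge0.
have d0 : 0 <= d by rewrite addr_ge0 ?l1norm_ge0// mulr_ge0.
have fw : l1norm (fluct_weight p eps X S - fluct_weight p eps' X' S') <= b1 * b1 * d.
  have -> : fluct_weight p eps X S - fluct_weight p eps' X' S' = (cB1 p)^T *m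
     ((1 - eps) *: (X - X') + eps *: (S - S') + (eps - eps') *: (S' - X')) *m cB1 p.
    have -> : (1 - eps) *: (X - X') + eps *: (S - S') + (eps - eps') *: (S' - X') =
      ((1 - eps) *: X + eps *: S) - ((1 - eps') *: X' + eps' *: S').
      by apply/matrixP => i j; rewrite !mxE; ring.
    rewrite /fluct_weight mulmxBr mulmxBl; move: (_ *m _ *m _) (_ *m _ *m _) => u v.
    by rewrite opprD addrACA subrr add0r.
  apply: le_trans (bd _ _ _ _) _; rewrite ler_wpM2l// /d YY.
  apply: le_trans (l1normD _ _) _; apply: lerD.
    apply: le_trans (l1normD _ _) _; rewrite !l1normZ !ger0_norm ?subr_ge0//.
    by rewrite lerD// ler_piMl ?l1norm_ge0// gerBl.
  rewrite l1normZ ler_wpM2l//; apply: le_trans (l1normB _ _) _.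
  by apply: le_trans YC; rewrite l1norm_hsub addrC.
have dle : l1norm (S - S') <= d.
  by rewrite /d YY -addrA addrCA lerDl addr_ge0 ?l1norm_ge0// mulr_ge0.
split.
  by apply: le_trans fw _; rewrite ler_wpM2r// lerDl.
have -> : mean_weight p eps X S - mean_weight p eps' X' S' =
    (fluct_weight p eps X S - fluct_weight p eps' X' S')
    + (cB0 p)^T *m (S - S') *m cB0 p.
  rewrite /mean_weight mulmxBr mulmxBl; move: (_ *m _ *m _) (_ *m _ *m _) => u v.
  by rewrite opprD addrACA.
apply: le_trans (l1normD _ _) _; rewrite [leRHS]mulrDl lerD//.
by apply: le_trans (bd _ _ _ _) _; rewrite ler_wpM2l.
Qed.

Lemma pair_rhs_lip (R : realType) (n n1 : nat) (p : social_problem R n n1)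
    (c C : R) : 0 < c -> 0 <= C ->
  exists2 L : R, 0 <= L & forall eps eps' (Y Y' : 'M[R]_(n, n + n)),
    admissible p c C eps Y -> admissible p c C eps' Y' ->
    l1norm (pair_rhs p eps Y - pair_rhs p eps' Y') <=
      L * (l1norm (Y - Y') + `|eps - eps'|).
Proof.
move=> c0 C0; have [K K0 KP] := weight_lip p.
have [La La0 LaP] := ric_lip (cB p) (cA p) c0 C0.
have [Lm Lm0 LmP] := ric_lip (cB p) (cA p + cG p) c0 C0.
exists ((La + Lm) * (1 + K * (1 + C))); first by rewrite mulr_ge0 ?addr_ge0 ?mulr_ge0 ?addr_ge0.
move=> eps eps' Y Y' [e01 YC Yf Ym] [e01' YC' Yf' Ym'].
have [Kf Km] := KP eps eps' C Y Y' e01 YC'.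
rewrite /pair_rhs opp_row_mx add_row_mx l1norm_row_mx.
have subC (Z : 'M[R]_(n, n + n)) : l1norm Z <= C ->
    l1norm (lsubmx Z) <= C /\ l1norm (rsubmx Z) <= C.
  rewrite l1norm_hsub; have := l1norm_ge0 (lsubmx Z); have := l1norm_ge0 (rsubmx Z).
  by move=> ? ? ?; split; lra.
have [XC SC] := subC _ YC; have [XC' SC'] := subC _ YC'.
have lY : l1norm (lsubmx Y - lsubmx Y') <= l1norm (Y - Y').
  by rewrite [leRHS]l1norm_hsub !linearB/= lerDl l1norm_ge0.
have rY : l1norm (rsubmx Y - rsubmx Y') <= l1norm (Y - Y').
  by rewrite [leRHS]l1norm_hsub !linearB/= lerDr l1norm_ge0.
have h1 := LaP (cQ p) _ _ _ _ XC XC' Yf Yf'.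
have h2 := LmP (cQ p + QGamma p) _ _ _ _ SC SC' Ym Ym'.
set e := `|eps - eps'| in Kf Km *; set y := l1norm (Y - Y') in lY rY Kf Km *.
have e0 : 0 <= e by exact: normr_ge0.
have y0 : 0 <= y by exact: l1norm_ge0.
have tot : y + K * (y + e * C) <= (1 + K * (1 + C)) * (y + e).
  rewrite -subr_ge0.
  have -> : (1 + K * (1 + C)) * (y + e) - (y + K * (y + e * C)) =
    e + K * e + K * C * y by ring.
  by rewrite !addr_ge0 ?mulr_ge0.
rewrite -mulrA mulrDl; apply: lerD.
  apply: le_trans h1 _; rewrite ler_wpM2l//; apply: le_trans tot; exact: lerD.
apply: le_trans h2 _; rewrite ler_wpM2l//; apply: le_trans tot; exact: lerD.
Qed.

(** Continuous dependence on [eps = 1/N]; for [eps = eps'] it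
    is a uniqueness statement. *)
Lemma pair_gronwall (R : realType) (n n1 : nat) (p : social_problem R n n1)
    (c C : R) : 0 < c -> 0 <= C ->
  exists2 K : R, 0 <= K & forall eps eps' (Y Y' : R -> 'M[R]_(n, n + n)),
    Y (horizon p) = Y' (horizon p) ->
    (forall t, 0 <= t <= horizon p -> admissible p c C eps (Y t) /\
       has_derivative_in (horizon p) Y t (pair_rhs p eps (Y t))) ->
    (forall t, 0 <= t <= horizon p -> admissible p c C eps' (Y' t) /\
       has_derivative_in (horizon p) Y' t (pair_rhs p eps' (Y' t))) ->
    forall t, 0 <= t <= horizon p -> l1norm (Y t - Y' t) <= K * `|eps - eps'|.
Proof.
move=> c0 C0; have [L L0 LP] := pair_rhs_lip p c0 C0.
exists (gronwall_const n (n + n) (horizon p) L * L).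
  by rewrite mulr_ge0// gronwall_const_ge0.
move=> eps eps' Y Y' YT H H' t tT; rewrite -mulrA.
apply: (@gronwall R _ _ (horizon p) L (C + C) (L * `|eps - eps'|)
  (fun s => Y s - Y' s)
  (fun s => pair_rhs p eps (Y s) - pair_rhs p eps' (Y' s))) => //.
- by rewrite mulr_ge0.
- by rewrite YT subrr.
- by move=> s sT; apply: has_derivative_inB; [case: (H s sT)|case: (H' s sT)].
- move=> s sT; have [[_ h _ _] _] := H s sT; have [[_ h' _ _] _] := H' s sT.
  by apply: le_trans (l1normB _ _) _; rewrite lerD.
- move=> s sT; have [h _] := H s sT; have [h' _] := H' s sT.
  by rewrite -mulrDr LP.
Qed.

(** * Symmetry of the coupled small system *)

Lemma tr_fluct_weight (R : realType) (n n1 : nat) (p : social_problem R n n1)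
    eps (X S : 'M[R]_n) :
  (fluct_weight p eps X S)^T = fluct_weight p eps X^T S^T.
Proof.
rewrite /fluct_weight linearD/= (cR_sym p) !trmx_mul trmxK mulmxA.
congr (_ + _ *m _ *m _).
by apply/matrixP => i j; rewrite !mxE.
Qed.

Lemma tr_mean_weight (R : realType) (n n1 : nat) (p : social_problem R n n1)
    eps (X S : 'M[R]_n) :
  (mean_weight p eps X S)^T = mean_weight p eps X^T S^T.
Proof.
by rewrite /mean_weight linearD/= tr_fluct_weight !trmx_mul trmxK mulmxA.
Qed.

Lemma symmx_QGamma (R : realType) (n n1 : nat) (p : social_problem R n n1) :
  symmx (QGamma p).
Proof.
rewrite /symmx /QGamma !linearB/= !trmx_mul trmxK (cQ_sym p) mulmxA.
by rewrite addrAC.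
Qed.

(** Transposes both components, which is not the transpose of the block row. *)
Definition tr_pair (R : realType) (n : nat) (Y : 'M[R]_(n, n + n)) :
    'M[R]_(n, n + n) := row_mx (lsubmx Y)^T (rsubmx Y)^T.

Lemma tr_pair_rhs (R : realType) (n n1 : nat) (p : social_problem R n n1)
    eps (Y : 'M[R]_(n, n + n)) :
  pair_rhs p eps (tr_pair Y) = tr_pair (pair_rhs p eps Y).
Proof.
rewrite /pair_rhs /tr_pair !row_mxKl !row_mxKr /fluct_rhs /mean_rhs.
have Qs := cQ_sym p; have Qs' : symmx (cQ p + QGamma p).
  by rewrite /symmx linearD/= (cQ_sym p) symmx_QGamma.
by rewrite !tr_ric// tr_fluct_weight tr_mean_weight.
Qed.

Lemma l1norm_tr_pair (R : realType) (n : nat) (Y : 'M[R]_(n, n + n)) :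
  l1norm (tr_pair Y) = l1norm Y.
Proof. by rewrite l1norm_row_mx !l1norm_tr -l1norm_hsub. Qed.

Lemma admissible_tr (R : realType) (n n1 : nat) (p : social_problem R n n1)
    c C eps (Y : 'M[R]_(n, n + n)) :
  admissible p c C eps Y -> admissible p c C eps (tr_pair Y).
Proof.
move=> [e YC Yf Ym]; split; rewrite ?l1norm_tr_pair// /tr_pair row_mxKl row_mxKr.
  by rewrite -tr_fluct_weight; exact: coercive_tr.
by rewrite -tr_mean_weight; exact: coercive_tr.
Qed.

Lemma has_derivative_in_tr_pair (R : realType) (n : nat) (T : R)
    (Y : R -> 'M[R]_(n, n + n)) t dY :
  has_derivative_in T Y t dY ->
  has_derivative_in T (fun s => tr_pair (Y s)) t (tr_pair dY).
Proof.
apply: (@has_derivative_in_linear R T _ _ _ _ (@tr_pair R n) 1) => [a U V|U].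
  by apply/matrixP => i j; rewrite !mxE; case: (fintype.split j) => h; rewrite !mxE.
by rewrite l1norm_tr_pair mul1r.
Qed.

(** The transposed pair solves the same problem, so uniqueness forces
    symmetry. *)
Lemma pair_solution_sym (R : realType) (n n1 : nat) (p : social_problem R n n1)
    (c C eps : R) (Y : R -> 'M[R]_(n, n + n)) :
  0 < c -> 0 <= C -> tr_pair (Y (horizon p)) = Y (horizon p) ->
  (forall t, 0 <= t <= horizon p -> admissible p c C eps (Y t) /\
     has_derivative_in (horizon p) Y t (pair_rhs p eps (Y t))) ->
  forall t, 0 <= t <= horizon p -> symmx (lsubmx (Y t)) /\ symmx (rsubmx (Y t)).
Proof.
move=> c0 C0 YT H t tT; have [K K0 KP] := pair_gronwall p c0 C0.
have Htr s : 0 <= s <= horizon p -> admissible p c C eps (tr_pair (Y s)) /\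
    has_derivative_in (horizon p) (fun s => tr_pair (Y s)) s
      (pair_rhs p eps (tr_pair (Y s))).
  move=> sT; have [h1 h2] := H s sT; split; first exact: admissible_tr.
  by rewrite tr_pair_rhs; exact: has_derivative_in_tr_pair.
have := KP eps eps (fun s => tr_pair (Y s)) Y YT Htr H t tT.
rewrite subrr normr0 mulr0 => /l1norm_le0/eqP; rewrite subr_eq0 => /eqP YY.
by split; rewrite /symmx -[in RHS]YY /tr_pair ?row_mxKl ?row_mxKr.
Qed.

(** * From the large-scale equation to the limit system *)

Lemma fluct_part_lin (R : realType) (N k : nat) (i0 i1 : 'I_N) a
    (Y Z : 'M[R]_(N * k)) :
  fluct_part i0 i1 (Y - a *: Z) = fluct_part i0 i1 Y - a *: fluct_part i0 i1 Z.
Proof. by apply/matrixP => i j; rewrite !mxE; ring. Qed.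

Lemma mean_part_lin (R : realType) (N k : nat) (i0 i1 : 'I_N) a
    (Y Z : 'M[R]_(N * k)) :
  mean_part i0 i1 (Y - a *: Z) = mean_part i0 i1 Y - a *: mean_part i0 i1 Z.
Proof. by apply/matrixP => i j; rewrite !mxE; ring. Qed.

(** Uniqueness, applied to a solution and its relabellings, makes the solution
    exchangeable; its two parts then inherit equation, bounds and symmetry. *)
Lemma big_solution_pair (R : realType) (n n1 : nat) (p : social_problem R n n1)
    N (c K : R) (P : R -> 'M[R]_(N * n)) :
  (1 < N)%N -> 0 < c -> big_riccati_solution p P ->
  (forall t, 0 <= t <= horizon p -> coercive c (big_weight p (P t))) ->
  (forall t, 0 <= t <= horizon p -> l1norm (P t) / N%:R <= K) ->
  exists Y : R -> 'M[R]_(n, n + n),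
    Y (horizon p) = row_mx (cQf p) (cQf p + QfGamma p) /\
    forall t, 0 <= t <= horizon p ->
      [/\ admissible p c (K + K) N%:R^-1 (Y t),
          has_derivative_in (horizon p) Y t (pair_rhs p N%:R^-1 (Y t)),
          symmx (lsubmx (Y t)) & symmx (rsubmx (Y t))].
Proof.
move=> N1 c0 [Psol PT] Pc PK; have N0 : (0 < N)%N by apply: ltnW.
have NR : 0 < N%:R :> R by rewrite ltr0n.
have T0 := horizon_gt0 p.
have TT : 0 <= horizon p <= horizon p by rewrite lexx ltW.
have K0 : 0 <= K.
  by apply: le_trans (PK _ TT); rewrite divr_ge0// l1norm_ge0.
pose i0 : 'I_N := Ordinal N0; pose i1 : 'I_N := Ordinal N1.
have i01 : i0 != i1 by [].
have PN t : 0 <= t <= horizon p -> l1norm (P t) <= K * N%:R.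
  by move=> /PK; rewrite ler_pdivrMr.
have inv (s : {perm 'I_N}) t : 0 <= t <= horizon p -> relabelled s (P t) = P t.
  pose v := l1norm (relabel R n s); pose C := K * N%:R + v * (K * N%:R) * v.
  have v0 : 0 <= v := l1norm_ge0 _.
  have KN : 0 <= K * N%:R by rewrite mulr_ge0.
  have C0 : 0 <= C by rewrite addr_ge0// !mulr_ge0.
  have bd (Z : 'M[R]_(N * n)) : l1norm (relabelled s Z) <= v * l1norm Z * v.
    by apply: l1normM_le; [exact: l1normM|rewrite l1norm_tr].
  apply: (@big_riccati_unique R n n1 p N c C (fun t => relabelled s (P t)) P) => //.
  - by rewrite PT bigQf_exch relabelled_exch.
  - move=> x xT; have [_ Pd Wpos] := Psol x xT; split.
    + rewrite big_riccati_rhs_relabelled; last exact: coercive_unitmx c0 (Pc x xT).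
      apply: (has_derivative_in_linear (c := v * v)) Pd => [a Y Z|Z].
        by rewrite relabelledB /relabelled -scalemxAr -scalemxAl.
      by rewrite mulrAC; exact: bd.
    + apply: le_trans (bd _) _; rewrite /C; apply: ler_wpDl => //.
      by rewrite ler_wpM2r// ler_wpM2l// PN.
    + by rewrite big_weight_relabelled; apply: coercive_relabelled; exact: Pc.
  - move=> x xT; have [_ Pd Wpos] := Psol x xT; split => //; last exact: Pc.
    by apply: le_trans (PN x xT) _; rewrite /C lerDl !mulr_ge0.
pose X t := fluct_part i0 i1 (P t); pose S t := mean_part i0 i1 (P t).
have PXS t : 0 <= t <= horizon p -> P t = exch_mx N (X t) (S t).
  by move=> tT; apply: exchangeable_exch => // s; exact: inv.
exists (fun t => row_mx (X t) (S t)); split.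
  by rewrite /X /S PT bigQf_exch fluct_part_exch// mean_part_exch.
move=> t tT; have Pt := PXS t tT; have [Psym Pd Wpos] := Psol t tT.
have := Pc t tT; rewrite Pt big_weight_exch// => /(exch_coercive N1)[Wf Wm].
have [XK SK] := exch_l1norm (X t) (S t) i01.
split; rewrite ?row_mxKl ?row_mxKr.
- split; rewrite ?row_mxKl ?row_mxKr//.
    by rewrite invr_ge0 invf_le1// ltW//= ler1n.
  by rewrite l1norm_row_mx lerD// (le_trans XK, le_trans SK)// -Pt PK.
- rewrite /pair_rhs !row_mxKl !row_mxKr.
  have rhsE : big_riccati_rhs p (P t) = exch_mx N
      (fluct_rhs p N%:R^-1 (X t) (S t)) (mean_rhs p N%:R^-1 (X t) (S t)).
    rewrite [in LHS]Pt big_riccati_rhs_exch//.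
      exact: coercive_unitmx c0 Wf.
    exact: coercive_unitmx c0 Wm.
  pose f Z : 'M[R]_(n, n + n) := row_mx (fluct_part i0 i1 Z) (mean_part i0 i1 Z).
  have -> : row_mx (fluct_rhs p N%:R^-1 (X t) (S t))
      (mean_rhs p N%:R^-1 (X t) (S t)) = f (big_riccati_rhs p (P t)).
    by rewrite /f rhsE fluct_part_exch// mean_part_exch.
  apply: (has_derivative_in_linear (f := f) (c := 1 + 1 + (1 + `|N%:R - 1|))) Pd.
    move=> a Y Z; rewrite /f fluct_part_lin mean_part_lin.
    by rewrite scale_row_mx opp_row_mx add_row_mx.
  move=> Z; rewrite /f l1norm_row_mx mulrDl; apply: lerD.
    apply: le_trans (l1normB _ _) _; rewrite mulrDl mul1r.
    by rewrite lerD// l1norm_blk_le.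
  apply: le_trans (l1normD _ _) _; rewrite l1normZ mulrDl mul1r.
  by rewrite lerD ?l1norm_blk_le// ler_wpM2l// l1norm_blk_le.
- move: Psym; rewrite /symmx Pt tr_exch_mx => /(congr1 (fluct_part i0 i1)).
  by rewrite !fluct_part_exch.
- move: Psym; rewrite /symmx Pt tr_exch_mx => /(congr1 (mean_part i0 i1)).
  by rewrite !mean_part_exch.
Qed.

Lemma unif_lim_sym (R : realType) (k l : nat) (T t : R)
    (Y : nat -> R -> 'M[R]_(k, l)) (y : R -> 'M[R]_(k, l)) (m : nat)
    (f : 'M[R]_(k, l) -> 'M[R]_m) :
  unif_lim T Y y -> 0 <= t <= T ->
  (forall U V, l1norm (f U - f V) <= l1norm (U - V)) ->
  (forall a, symmx (f (Y a t))) -> symmx (f (y t)).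
Proof.
move=> Yy tT fl fs; apply/eqP; rewrite -subr_eq0; apply/eqP/l1norm_le0.
apply/ler_addgt0Pr => e e0; rewrite add0r.
have e20 : 0 < e / 2 by rewrite divr_gt0.
have [K KP] := Yy _ e20; have h := KP K (leqnn K) t tT.
have h' : l1norm (f (y t) - f (Y K t)) <= e / 2.
  by apply: le_trans (fl _ _) _; rewrite l1norm_distC.
apply: le_trans (l1norm_distD (f (Y K t)) _ _) _.
have -> : (f (y t))^T - f (Y K t) = (f (y t) - f (Y K t))^T.
  by rewrite linearB/= fs.
by rewrite l1norm_tr (l1norm_distC (f (Y K t))); lra.
Qed.

(** By [pair_gronwall] the distance of two members of the sequence is at most
    proportional to the difference of their [eps], which tends to 0; equation,
    bounds and symmetry pass to the uniform limit. *)
Lemma pair_limit (R : realType) (n n1 : nat) (p : social_problem R n n1)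
    (c C : R) (m : nat) (Y : nat -> R -> 'M[R]_(n, n + n)) (y_end : 'M[R]_(n, n + n)) :
  0 < c -> 0 <= C -> (0 < m)%N -> (forall k, Y k (horizon p) = y_end) ->
  (forall k t, 0 <= t <= horizon p ->
     [/\ admissible p c C (m + k)%:R^-1 (Y k t),
         has_derivative_in (horizon p) (Y k) t (pair_rhs p (m + k)%:R^-1 (Y k t)),
         symmx (lsubmx (Y k t)) & symmx (rsubmx (Y k t))]) ->
  exists y, y (horizon p) = y_end /\
    forall t, 0 <= t <= horizon p ->
     [/\ admissible p c C 0 (y t),
         has_derivative_in (horizon p) y t (pair_rhs p 0 (y t)),
         symmx (lsubmx (y t)) & symmx (rsubmx (y t))].
Proof.
move=> c0 C0 m0 Yend H; pose eps k : R := (m + k)%:R^-1.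
have small e : 0 < e -> exists K : nat, forall k, (K <= k)%N -> 0 <= eps k <= e.
  move=> e0; exists (Num.trunc e^-1).+1 => k Kk; rewrite /eps invr_ge0 ler0n/=.
  rewrite -[e]invrK lef_pV2 ?posrE ?invr_gt0//; last by rewrite ltr0n addn_gt0 m0.
  apply: le_trans (ltW (truncnS_gt _)) _; rewrite ler_nat.
  by apply: leq_trans Kk _; exact: leq_addl.
have T0 := horizon_gt0 p.
have [G G0 GP] := pair_gronwall p c0 C0.
have H2 k t : 0 <= t <= horizon p -> admissible p c C (eps k) (Y k t) /\
    has_derivative_in (horizon p) (Y k) t (pair_rhs p (eps k) (Y k t)).
  by move=> tT; have [] := H k t tT.
have [y Yy] : exists y, unif_lim (horizon p) Y y.
  apply: unif_lim_exists => e e0; have G1 : 0 < G + 1 by rewrite ltr_wpDl.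
  have [K KP] := small _ (divr_gt0 e0 G1); exists K => a b Ka Kb t tT.
  have := GP (eps a) (eps b) (Y a) (Y b) _ (H2 a) (H2 b) t tT.
  rewrite !Yend => /(_ erefl)/le_trans; apply.
  apply: (@le_trans _ _ (G * (e / (G + 1)))).
    rewrite ler_wpM2l// ler_norml; have /andP[? ?] := KP a Ka.
    by have /andP[? ?] := KP b Kb; apply/andP; split; lra.
  by rewrite mulrCA ler_piMr ?(ltW e0)// ler_pdivrMr// mul1r lerDl.
have yend : y (horizon p) = y_end.
  apply/eqP; rewrite -subr_eq0; apply/eqP/l1norm_le0.
  apply: (unif_lim_bound Yy); first by rewrite lexx ltW.
  by move=> k; rewrite Yend subrr l1norm0.
have [W W0 WP] := weight_lip p.
have yadm t : 0 <= t <= horizon p -> admissible p c C 0 (y t).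
  move=> tT.
  have yC : l1norm (y t) <= C.
    have := @unif_lim_bound _ _ _ _ Y y 0 C t Yy tT; rewrite subr0; apply => k.
    by have [[_ + _ _] _] := H2 k t tT; rewrite subr0.
  have near_w e : 0 < e -> exists k, W * (l1norm (y t - Y k t) + `|0 - eps k| * C) <= e.
    move=> e0; pose d := W * (1 + C) + 1.
    have d0 : 0 < d by rewrite /d ltr_wpDl// mulr_ge0// addr_ge0.
    have [K KP] := small _ (divr_gt0 e0 d0); have [K' KP'] := Yy _ (divr_gt0 e0 d0).
    exists (maxn K K'); have /andP[h1 h2] := KP _ (leq_maxl K K').
    have h3 := KP' _ (leq_maxr K K') t tT.
    rewrite l1norm_distC sub0r normrN ger0_norm//.
    apply: (@le_trans _ _ (W * (e / d + e / d * C))).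
      by rewrite ler_wpM2l// lerD// ler_wpM2r.
    have -> : W * (e / d + e / d * C) = e * ((d - 1) / d).
      by rewrite /d; ring.
    by rewrite ler_piMr ?(ltW e0)// ler_pdivrMr// mul1r gerBl.
  split => //; first by rewrite lexx ler01.
    apply: coercive_closed => e e0; have [k kP] := near_w e e0.
    have [[_ YC Yf _] _] := H2 k t tT.
    exists (fluct_weight p (eps k) (lsubmx (Y k t)) (rsubmx (Y k t))); split => //.
    apply: le_trans kP; have [] := WP 0 (eps k) C (y t) (Y k t) _ YC => //.
    by rewrite lexx ler01.
  apply: coercive_closed => e e0; have [k kP] := near_w e e0.
  have [[_ YC _ Ym] _] := H2 k t tT.
  exists (mean_weight p (eps k) (lsubmx (Y k t)) (rsubmx (Y k t))); split => //.
  apply: le_trans kP; have [] := WP 0 (eps k) C (y t) (Y k t) _ YC => //.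
  by rewrite lexx ler01.
have [L L0 LP] := pair_rhs_lip p c0 C0.
have dlim : unif_lim (horizon p) (fun k t => pair_rhs p (eps k) (Y k t))
    (fun t => pair_rhs p 0 (y t)).
  move=> e e0; pose d := 2 * L + 1; have d0 : 0 < d by rewrite /d ltr_wpDl// mulr_ge0.
  have [K KP] := small _ (divr_gt0 e0 d0); have [K' KP'] := Yy _ (divr_gt0 e0 d0).
  exists (maxn K K') => k; rewrite geq_max => /andP[Kk K'k] t tT.
  have [h1 _] := H2 k t tT; apply: le_trans (LP _ _ _ _ h1 (yadm t tT)) _.
  have /andP[h2 h3] := KP k Kk; have h4 := KP' k K'k t tT.
  rewrite subr0 ger0_norm//.
  apply: (@le_trans _ _ (L * (e / d + e / d))); first by rewrite ler_wpM2l// lerD.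
  have -> : L * (e / d + e / d) = e * ((d - 1) / d) by rewrite /d; ring.
  by rewrite ler_piMr ?(ltW e0)// ler_pdivrMr// mul1r gerBl.
exists y; split => // t tT; split.
- exact: yadm.
- apply: (unif_lim_deriv _ Yy dlim) tT => k x xT.
  by have [_] := H2 k x xT.
- apply: (unif_lim_sym (f := lsubmx) Yy tT) => [U V|k]; last by have [] := H k t tT.
  by rewrite -linearB/= [leRHS]l1norm_hsub lerDl l1norm_ge0.
- apply: (unif_lim_sym (f := rsubmx) Yy tT) => [U V|k]; last by have [] := H k t tT.
  by rewrite -linearB/= [leRHS]l1norm_hsub lerDr l1norm_ge0.
Qed.

Lemma fluct_weight0 (R : realType) (n n1 : nat) (p : social_problem R n n1)
    (X S : 'M[R]_n) : fluct_weight p 0 X S = R1 p X.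
Proof. by rewrite /fluct_weight subr0 scale1r scale0r addr0. Qed.

Lemma mean_weight0 (R : realType) (n n1 : nat) (p : social_problem R n n1)
    (X L2 : 'M[R]_n) : mean_weight p 0 X (X + L2) = R2 p X L2.
Proof. by rewrite /mean_weight fluct_weight0. Qed.

Lemma fluct_rhs0 (R : realType) (n n1 : nat) (p : social_problem R n n1)
    (X S : 'M[R]_n) : fluct_rhs p 0 X S = Psi1 p X.
Proof. by rewrite /fluct_rhs fluct_weight0. Qed.

Lemma mean_rhs0 (R : realType) (n n1 : nat) (p : social_problem R n n1)
    (X L2 : 'M[R]_n) : mean_rhs p 0 X (X + L2) = Psi1 p X + Psi2 p X L2.
Proof.
rewrite /mean_rhs mean_weight0 /ric /Psi1 /Psi2.
have -> : (X + L2) *m (cA p + cG p) =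
    X *m cA p + (X *m cG p + L2 *m (cA p + cG p)) by rewrite mulmxDl mulmxDr addrA.
have -> : (cA p + cG p)^T *m (X + L2) = (cA p)^T *m X
    + ((cG p)^T *m X + ((cA p)^T + (cG p)^T) *m L2).
  have -> : (cA p + cG p)^T = (cA p)^T + (cG p)^T by rewrite linearD.
  by rewrite mulmxDr addrA -mulmxDl.
move: (_ *m (cB p)^T *m X) (_ *m (cB p)^T *m (X + L2)) => u v.
move: (X *m cA p) (X *m cG p + _) ((cA p)^T *m X) ((cG p)^T *m X + _) => a1 a2 a3 a4.
by apply/matrixP => i j; rewrite !mxE; ring.
Qed.

Lemma asymptotic_to_limit (R : realType) (n n1 : nat) (p : social_problem R n n1) :
  asymptotic_solvability p ->
  exists L1 L2 : R -> 'M[R]_n, limit_ode_solution p L1 L2.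
Proof.
move=> [N0 [P [N00 Psol Psup [c [c0 Pc]]]]].
have [K PK] : exists K, forall N t, (N0 <= N)%N -> 0 <= t <= horizon p ->
    l1norm (P N t) / N%:R <= K.
  move: Psup; set s := ereal_sup _ => s_fin.
  have ub N t : (N0 <= N)%N -> 0 <= t <= horizon p ->
      ((l1norm (P N t) / N%:R)%:E <= s)%E.
    move=> N0N tT; apply: (@le_trans _ _ (ereal_sup [set (l1norm (P N t) / N%:R)%:E
        | t in [set t : R | (0 <= t <= horizon p)%R]])).
      by apply: ereal_sup_ubound; exists t.
    by apply: ereal_sup_ubound; exists N.
  case: s s_fin ub => [r _ ub|//|_ ub].
    by exists r => N t N0N tT; rewrite -lee_fin; exact: ub.
  by exists 0 => N t N0N tT; have := ub N t N0N tT; rewrite leeNy_eq.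
have T0 := horizon_gt0 p.
have TT : 0 <= horizon p <= horizon p by rewrite lexx ltW.
have K0 : 0 <= K.
  by apply: le_trans (PK N0 (horizon p) (leqnn _) TT); rewrite divr_ge0// l1norm_ge0.
(* two agents are needed to have an off-diagonal block *)
pose m := maxn N0 2.
have mN0 k : (N0 <= m + k)%N.
  by apply: leq_trans (leq_maxl N0 2) _; exact: leq_addr.
have m1 k : (1 < m + k)%N.
  by apply: leq_trans (leq_maxr N0 2) _; exact: leq_addr.
have ex k := @big_solution_pair R n n1 p (m + k) c K (P (m + k)%N) (m1 k) c0
  (Psol _ (mN0 k))
  (fun t tT => ((loewner_scalarP c _).1 (Pc _ t (mN0 k) tT)).2)
  (fun t tT => PK _ t (mN0 k) tT).
have [Y YP] := choice ex.
have mpos : (0 < m)%N by rewrite ltnW// -(addn0 m).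
have [y [yT yP]] := @pair_limit R n n1 p c (K + K) m Y _ c0 (addr_ge0 K0 K0) mpos
  (fun k => (YP k).1) (fun k => (YP k).2).
exists (fun t => lsubmx (y t)), (fun t => rsubmx (y t) - lsubmx (y t)).
have yS t : rsubmx (y t) = lsubmx (y t) + (rsubmx (y t) - lsubmx (y t)).
  by rewrite addrC subrK.
split.
- move=> t tT; have [_ _ Xs Ss] := yP t tT; split => //.
  by rewrite /symmx linearB/= Xs Ss.
- split.
  + move=> t tT; have [_ yd _ _] := yP t tT; have := has_derivative_in_lsub yd.
    by rewrite row_mxKl fluct_rhs0.
  + by rewrite yT row_mxKl.
  + move=> t tT; have [[_ _ Wf _] _ Xs _] := yP t tT.
    apply: coercive_posdef c0 _ _; last by rewrite -(fluct_weight0 p _ (rsubmx (y t))).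
    by rewrite /symmx -(fluct_weight0 p _ (rsubmx (y t))) tr_fluct_weight !fluct_weight0 Xs.
- split.
  + move=> t tT; have [_ yd _ _] := yP t tT.
    have := has_derivative_inB (has_derivative_in_rsub yd) (has_derivative_in_lsub yd).
    rewrite row_mxKl row_mxKr fluct_rhs0 [in mean_rhs _ _ _ _]yS mean_rhs0.
    by rewrite addrAC subrr add0r.
  + by rewrite yT row_mxKl row_mxKr addrAC subrr add0r.
  + move=> t tT; have [[_ _ _ Wm] _ Xs Ss] := yP t tT.
    rewrite -mean_weight0 -yS; apply: coercive_posdef c0 _ Wm.
    by rewrite /symmx tr_mean_weight Xs Ss.
Qed.

(** * From the limit system to the large-scale equation *)

(** The limit solution is an approximate solution of the system for small
    [eps], with defect proportional to [eps]; Picard iteration in a tube around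
    it, on which the weights remain coercive, produces an exact one. *)
Lemma pair_near_limit (R : realType) (n n1 : nat) (p : social_problem R n n1)
    (L1 L2 : R -> 'M[R]_n) : limit_ode_solution p L1 L2 ->
  exists c C E : R, [/\ 0 < c, 0 <= C, 0 < E &
    forall eps, 0 <= eps <= E -> exists Y : R -> 'M[R]_(n, n + n),
      Y (horizon p) = row_mx (cQf p) (cQf p + QfGamma p) /\
      forall t, 0 <= t <= horizon p ->
       [/\ admissible p c C eps (Y t),
           has_derivative_in (horizon p) Y t (pair_rhs p eps (Y t)),
           symmx (lsubmx (Y t)) & symmx (rsubmx (Y t))]].
Proof.
move=> [Lsym [L1d L1T L1pos] [L2d L2T L2pos]]; have T0 := horizon_gt0 p.
have TT : 0 <= horizon p <= horizon p by rewrite lexx ltW.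
pose y0 t : 'M[R]_(n, n + n) := row_mx (L1 t) (L1 t + L2 t).
have y0d t : 0 <= t <= horizon p ->
    has_derivative_in (horizon p) y0 t (pair_rhs p 0 (y0 t)).
  move=> tT; rewrite /pair_rhs row_mxKl row_mxKr fluct_rhs0 mean_rhs0.
  apply: has_derivative_in_row_mx; first exact: L1d.
  exact: has_derivative_inD (L1d t tT) (L2d t tT).
have y0c := has_derivative_in_cont y0d.
have [C0 C00 y0C] := cont_mx_bounded y0c.
have [W W0 WP] := weight_lip p.
have cont_w (w : 'M[R]_(n, n + n) -> 'M[R]_n1) :
    (forall Y Y', l1norm (w Y - w Y') <= W * l1norm (Y - Y')) ->
    cont_mx (horizon p) (fun t => w (y0 t)).
  move=> wl t tT e e0; have W1 : 0 < W + 1 by rewrite ltr_wpDl.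
  have [h h0 hP] := y0c t tT _ (divr_gt0 e0 W1); exists h => // s sT st.
  apply: le_trans (wl _ _) _.
  apply: (@le_trans _ _ (W * (e / (W + 1)))); first by rewrite ler_wpM2l// hP.
  by rewrite mulrCA ler_piMr ?(ltW e0)// ler_pdivrMr// mul1r lerDl.
have z01 : ((0 : R) <= (0 : R) <= (1 : R)) by apply/andP; split; lra.
have z0 : `|0 - 0 : R| = 0 by rewrite subrr normr0.
have [cf cf0 cfP] : exists2 c, 0 < c & forall t, 0 <= t <= horizon p ->
    coercive c (fluct_weight p 0 (lsubmx (y0 t)) (rsubmx (y0 t))).
  apply: coercive_uniform.
    apply: (cont_w (fun Y => fluct_weight p 0 (lsubmx Y) (rsubmx Y))) => Y Y'.
    by have [+ _] := WP 0 0 _ Y Y' z01 (lexx _); rewrite z0 mul0r addr0.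
  by move=> t tT; rewrite row_mxKl fluct_weight0; exact: L1pos.
have [cm cm0 cmP] : exists2 c, 0 < c & forall t, 0 <= t <= horizon p ->
    coercive c (mean_weight p 0 (lsubmx (y0 t)) (rsubmx (y0 t))).
  apply: coercive_uniform.
    apply: (cont_w (fun Y => mean_weight p 0 (lsubmx Y) (rsubmx Y))) => Y Y'.
    by have [_] := WP 0 0 _ Y Y' z01 (lexx _); rewrite z0 mul0r addr0.
  by move=> t tT; rewrite row_mxKl row_mxKr mean_weight0; exact: L2pos.
pose c := Num.min cf cm / 2.
have c0 : 0 < c by rewrite divr_gt0// lt_min cf0.
have ccf : c <= cf - c by rewrite lerBrDr -splitr ge_min lexx.
have ccm : c <= cm - c by rewrite lerBrDr -splitr ge_min lexx orbT.
have W2 : 0 < 2 * W + 1 by rewrite ltr_wpDl// mulr_ge0.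
(* [W] times a perturbation of size [2 * r] costs at most [c], half of the
   coercivity available along the limit solution *)
pose r := c / (2 * W + 1); have r0 : 0 < r by rewrite divr_gt0.
pose C := C0 + r; have CC : 0 <= C by rewrite addr_ge0// ltW.
have [L LL0 LP] := pair_rhs_lip p c0 CC.
pose g := gronwall_const n (n + n) (horizon p) L.
have g0 : 0 <= g by exact: gronwall_const_ge0.
have Cr : 0 < C0 + 1 by rewrite ltr_wpDl.
have gL : 0 < g * L + 1 by rewrite ltr_wpDl// mulr_ge0.
pose E := Num.min 1 (Num.min (r / (C0 + 1)) (r / (g * L + 1))).
have E0 : 0 < E by rewrite !lt_min ltr01 (divr_gt0 r0 Cr) (divr_gt0 r0 gL).
exists c, C, E; split => // eps /andP[e0 eE].
have [e1 er eg] : [/\ eps <= 1, eps * C0 <= r & g * (L * eps) <= r].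
  move: eE; rewrite !le_min => /and3P[-> h1 h2]; split => //.
    apply: (@le_trans _ _ (eps * (C0 + 1))); first by rewrite ler_wpM2l// lerDl.
    by rewrite -ler_pdivlMr.
  rewrite mulrA; apply: (@le_trans _ _ (eps * (g * L + 1))).
    by rewrite mulrC ler_wpM2l// lerDl.
  by rewrite -ler_pdivlMr.
have tube eps' t Y : 0 <= eps' <= eps -> 0 <= t <= horizon p ->
    l1norm (Y - y0 t) <= r -> admissible p c C eps' Y.
  move=> /andP[e'0 e'e] tT Yr; have e'1 : 0 <= eps' <= 1.
    by rewrite e'0 (le_trans e'e).
  have wr : W * (l1norm (Y - y0 t) + `|eps' - 0| * C0) <= c.
    apply: (@le_trans _ _ (W * (r + r))).
      rewrite ler_wpM2l// lerD// subr0 ger0_norm//; apply: le_trans er.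
      by rewrite ler_wpM2r.
    have -> : W * (r + r) = c * (2 * W / (2 * W + 1)) by rewrite /r; ring.
    by rewrite ler_piMr ?(ltW c0)// ler_pdivrMr// mul1r lerDl.
  have [Wf Wm] := WP eps' 0 C0 Y (y0 t) e'1 (y0C t tT).
  split => //.
  - rewrite -(subrK (y0 t) Y); apply: le_trans (l1normD _ _) _.
    by rewrite /C addrC lerD// y0C.
  - apply: coercive_perturb (cfP t tT) _; apply: le_trans Wf _.
    apply: le_trans wr ccf.
  - apply: coercive_perturb (cmP t tT) _; apply: le_trans Wm _.
    apply: le_trans wr ccm.
have ee : 0 <= eps <= eps by rewrite e0 lexx.
have [|||||| Y [YT Yd Yr]] := @picard_near R n (n + n) (horizon p) L r (L * eps)
  (admissible p c C eps) (pair_rhs p eps) y0 (fun t => pair_rhs p 0 (y0 t))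
  T0 LL0.
- by rewrite mulr_ge0.
- exact: eg.
- exact: y0d.
- by move=> t Y tT; exact: tube.
- move=> Y Z Ya Za; have := LP eps eps Y Z Ya Za.
  by rewrite (subrr eps) normr0 addr0.
- move=> t tT.
  have a1 : admissible p c C eps (y0 t).
    by apply: (tube eps t) => //; rewrite subrr l1norm0 ltW.
  have a2 : admissible p c C 0 (y0 t).
    by apply: (tube 0 t) => //; rewrite ?lexx// subrr l1norm0 ltW.
  have := LP eps 0 _ _ a1 a2.
  by rewrite (subrr (y0 t)) l1norm0 add0r (subr0 eps) ger0_norm.
have YTE : Y (horizon p) = row_mx (cQf p) (cQf p + QfGamma p).
  by rewrite YT /y0 L1T L2T.
have Yadm t : 0 <= t <= horizon p -> admissible p c C eps (Y t).
  by move=> tT; apply: (tube eps t) => //; apply: le_trans (Yr t tT) eg.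
exists Y; split => // t tT.
have [s1 s2] := @pair_solution_sym R n n1 p c C eps Y c0 CC
  ltac:(by rewrite YT /tr_pair /y0 row_mxKl row_mxKr; have [a1 a2] := Lsym _ TT;
         congr row_mx; [exact: a1 | rewrite linearD/= a1 a2])
  (fun s sT => conj (Yadm s sT) (Yd s sT)) t tT.
by split => //; [exact: Yadm | exact: Yd].
Qed.

(** An exchangeable matrix with bounded parts has l1 norm of order [N], and its
    weight is as coercive as the two small weights. *)
Lemma limit_to_asymptotic (R : realType) (n n1 : nat) (p : social_problem R n n1)
    (L1 L2 : R -> 'M[R]_n) :
  limit_ode_solution p L1 L2 -> asymptotic_solvability p.
Proof.
move=> /pair_near_limit[c [C [E [c0 C0 E0 ex]]]].
pose N0 := (Num.trunc E^-1).+1.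
have NE N : (N0 <= N)%N -> 0 <= (N%:R : R)^-1 <= E.
  move=> N0N; rewrite invr_ge0 ler0n/= -[E]invrK.
  rewrite lef_pV2 ?posrE ?invr_gt0//; last by rewrite ltr0n (leq_trans _ N0N).
  by apply: le_trans (ltW (truncnS_gt _)) _; rewrite ler_nat.
have /choice[Y YP] N : exists Y : R -> 'M[R]_(n, n + n), (N0 <= N)%N ->
    Y (horizon p) = row_mx (cQf p) (cQf p + QfGamma p) /\
    forall t, 0 <= t <= horizon p ->
       [/\ admissible p c C N%:R^-1 (Y t),
           has_derivative_in (horizon p) Y t (pair_rhs p N%:R^-1 (Y t)),
           symmx (lsubmx (Y t)) & symmx (rsubmx (Y t))].
  have [N0N|_] := leqP N0 N; last by exists (fun=> 0).
  by have [Y YP] := ex _ (NE N N0N); exists Y.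
pose f N (Z : 'M[R]_(n, n + n)) : 'M[R]_(N * n) := exch_mx N (lsubmx Z) (rsubmx Z).
have f_le N Z : (0 < N)%N -> l1norm (f N Z) / N%:R <= 2 * l1norm Z.
  move=> Npos; apply: le_trans (l1norm_exch _ _ Npos) _.
  have := l1normB (rsubmx Z) (lsubmx Z); rewrite (l1norm_hsub Z).
  by have := l1norm_ge0 (rsubmx Z); lra.
have wE N t : (N0 <= N)%N -> 0 <= t <= horizon p ->
    symmx (big_weight p (f N (Y N t))) /\ coercive c (big_weight p (f N (Y N t))).
  move=> N0N tT; have Npos : (0 < N)%N by apply: leq_trans N0N.
  have [_ /(_ t tT)[[_ _ Wf Wm] _ Xs Ss]] := YP N N0N.
  rewrite big_weight_exch//; split; last exact: coercive_exch.
  by rewrite /symmx tr_exch_mx tr_fluct_weight tr_mean_weight Xs Ss.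
exists N0, (fun N t => f N (Y N t)); split => //.
- move=> N N0N; have Npos : (0 < N)%N by apply: leq_trans N0N.
  have [YT Yt] := YP N N0N; split; last by rewrite /f YT row_mxKl row_mxKr bigQf_exch.
  move=> t tT; have [[_ _ Wf Wm] Yd Xs Ss] := Yt t tT; split.
  + by rewrite /symmx tr_exch_mx Xs Ss.
  + rewrite big_riccati_rhs_exch//; last 2 first.
    * exact: coercive_unitmx c0 Wf.
    * exact: coercive_unitmx c0 Wm.
    have -> : exch_mx N (fluct_rhs p N%:R^-1 (lsubmx (Y N t)) (rsubmx (Y N t)))
        (mean_rhs p N%:R^-1 (lsubmx (Y N t)) (rsubmx (Y N t))) =
        f N (pair_rhs p N%:R^-1 (Y N t)) by rewrite /f row_mxKl row_mxKr.
    apply: (has_derivative_in_linear (c := 2 * N%:R)) Yd => [a U V|Z].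
      rewrite /f exch_mxZ exch_mxB.
      by congr exch_mx; apply/matrixP => i j; rewrite !mxE.
    by rewrite mulrAC -ler_pdivrMr ?ltr0n// f_le.
  + by have [s1 s2] := wE N t N0N tT; exact: coercive_posdef c0 s1 s2.
- apply: (@le_lt_trans _ _ (2 * C)%:E); last exact: ltry.
  apply: ge_ereal_sup => _ [N /= N0N <-]; apply: ge_ereal_sup => _ [t /= tT <-].
  have Npos : (0 < N)%N by apply: leq_trans N0N.
  rewrite lee_fin; apply: le_trans (f_le _ _ Npos) _.
  by rewrite ler_wpM2l//; have [_ /(_ t tT)[[]]] := YP N N0N.
- exists c; split => // N t N0N tT; apply/loewner_scalarP; exact: wE.
Qed.

Theorem theorem3p1 (R : realType) (n n1 : nat) (hn : (0 < n)%N)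
    (hn1 : (0 < n1)%N) (p : social_problem R n n1) :
  asymptotic_solvability p <->
  exists L1 L2 : R -> 'M[R]_n, limit_ode_solution p L1 L2.
Proof.
split; first exact: asymptotic_to_limit.
by move=> [L1 [L2 L12]]; exact: limit_to_asymptotic L12.
Qed.
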